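(* There is a subgroup $G\subset \mathrm{Diff}^1_+([0,1])$ which is $C^1$-close to the identity and isomorphic to the free group $\mathbb F_2$ on two generators.
   Context: A group $G\subset \mathrm{Diff}^1_+([0,1])$ is $C^1$-close to the identity if there is a sequence $h_n\in \mathrm{Diff}^1_+([0,1])$ such that $h_n g h_n^{-1}\to \mathrm{id}$ in the $C^1$-topology as $n\to\infty$, for every $g\in G$. *)

(* Defs.v *)
From Stdlib Require Import Reals List.
Open Scope R_scope.

Definition I01 (x : R) : Prop := 0 <= x <= 1.

Definition is_deriv01 (f d : R -> R) : Prop :=
  forall x, I01 x ->
    limit1_in (fun y => (f y - f x) / (y - x)) (fun y => I01 y /\ y <> x) (d x) x.

Definition cont01 (d : R -> R) : Prop :=
  forall x, I01 x -> limit1_in d I01 (d x) x.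

Definition C1_01 (f : R -> R) : Prop :=
  exists d, is_deriv01 f d /\ cont01 d.

Definition maps01 (f : R -> R) : Prop := forall x, I01 x -> I01 (f x).

Definition inv01 (f g : R -> R) : Prop :=
  maps01 f /\ maps01 g /\
  (forall x, I01 x -> g (f x) = x) /\ (forall x, I01 x -> f (g x) = x).

(* f (restricted to [0,1]) is an element of Diff^1_+([0,1]):
   a C^1 diffeomorphism of [0,1] with C^1 inverse, fixing 0 and 1
   (i.e. orientation preserving). *)
Definition Diff1plus (f : R -> R) : Prop :=
  C1_01 f /\ f 0 = 0 /\ f 1 = 1 /\
  exists g, inv01 f g /\ C1_01 g.

Definition C1_conv_id (k : nat -> R -> R) : Prop :=
  (forall n, C1_01 (k n)) /\
  forall eps, eps > 0 -> exists N, forall n, (n >= N)%nat ->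
    forall d, is_deriv01 (k n) d ->
      forall x, I01 x -> Rabs (k n x - x) < eps /\ Rabs (d x - 1) < eps.

(* Words in the free group on two generators a (false) and b (true):
   a letter is (generator, inverted?). *)
Definition letter := (bool * bool)%type.

Definition cancels (l1 l2 : letter) : Prop :=
  fst l1 = fst l2 /\ snd l1 <> snd l2.

Fixpoint reduced (w : list letter) : Prop :=
  match w with
  | nil => True
  | l1 :: rest =>
      match rest with
      | nil => True
      | l2 :: _ => ~ cancels l1 l2 /\ reduced rest
      end
  end.

Definition eval_letter (f fi g gi : R -> R) (l : letter) : R -> R :=
  match l with
  | (false, false) => f
  | (false, true) => fi
  | (true, false) => g
  | (true, true) => gi
  end.

Fixpoint eval_word (f fi g gi : R -> R) (w : list letter) : R -> R :=
  match w with
  | nil => fun x => x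
  | l :: rest => fun x => eval_letter f fi g gi l (eval_word f fi g gi rest x)
  end.

(* Main.v *)
(** The free group acts faithfully, preserving a total order, on a countable set: integer lists in
    lexicographic order, a generator adding to every other entry the entry before it.  Fill [0,1] with
    adjacent intervals indexed by this set, of lengths [l n] with total 1 and with [l (s n) / l n -> 1]
    for every group element [s], and let [s] map the interval of [n] onto that of [s n].  The maps
    between intervals come from a cocycle (piecewise Moebius, tangent to the identity at the end
    points) with derivative uniformly close to 1 when the lengths are nearly equal, which makes the
    action C^1.  Replacing [l] by other lengths [l'] that agree with [l] outside a finite set amounts
    to a C^1 conjugation.  Large lengths can all be made equal in this way, so that the remaining
    ratios [l' (s n) / l' n] are uniformly close to 1, and the conjugate action is C^1-small. *)

Require Import Defs.
From Stdlib Require Import Reals ZArith Bool List Lra Lia FinFun Cantor IndefiniteDescription.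
From Coquelicot Require Import Coquelicot.
Open Scope R_scope.

(** The obstacle is non-amenability. Once the large lengths are equalised, the lengths form
    probability vectors on the index set that each group element moves by an arbitrarily small
    amount in the l^1 norm, so the action on that set must be amenable; the free group acting on
    itself with an invariant order cannot serve. On lists of one fixed length the two generators act
    by unipotent affine maps, hence through a nilpotent group, and there a weight of polynomial
    decay can be nearly invariant. No single length gives a faithful action, so all lengths occur
    together. The cocycle makes the relations automatic: group elements, conjugators and conjugates
    all have the form [Phi lt l l'], and only ratios of lengths remain to be estimated. *)

(** * Moebius maps between two intervals *)

Definition clamp (a y : R) : R := Rmax 0 (Rmin a y).

(** On each half of [[-a/2, a/2]] this is a Moebius map onto a half of [[-b/2, b/2]]. Its derivative
    is 1 at both end points, whatever [a] and [b], and [(b/a)^2] at the centre. *)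
Definition moebius (a b u : R) : R := b * b * u / (a * a + 2 * (b - a) * Rabs u).

(** Clamping makes [phi a b] constant on either side of [[0,a]], so that a single series over all
    intervals can define a map of [[0,1]]. *)
Definition phi (a b y : R) : R := b / 2 + moebius a b (clamp a y - a / 2).

Lemma clamp_bounds (a y : R) : 0 < a -> 0 <= clamp a y <= a.
Proof.
  intros Ha. unfold clamp, Rmax, Rmin.
  destruct (Rle_dec a y), (Rle_dec 0 _); lra.
Qed.

Lemma clamp_id (a y : R) : 0 <= y <= a -> clamp a y = y.
Proof.
  intros Ha. unfold clamp, Rmax, Rmin.
  destruct (Rle_dec a y), (Rle_dec 0 _); lra.
Qed.

Lemma clamp_le0 (a y : R) : 0 < a -> y <= 0 -> clamp a y = 0.
Proof.
  intros Ha Hy. unfold clamp, Rmax, Rmin.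
  destruct (Rle_dec a y), (Rle_dec 0 _); lra.
Qed.

Lemma clamp_ge (a y : R) : 0 < a -> a <= y -> clamp a y = a.
Proof.
  intros Ha Hy. unfold clamp, Rmax, Rmin.
  destruct (Rle_dec a y), (Rle_dec 0 _); lra.
Qed.

Lemma clamp_mono (a x y : R) : x <= y -> clamp a x <= clamp a y.
Proof.
  intros Hxy. apply Rle_max_compat_l, Rle_min_compat_l, Hxy.
Qed.

Lemma moebius_den (a b u : R) :
  0 < a -> 0 < b -> - (a / 2) <= u <= a / 2 -> 0 < a * a + 2 * (b - a) * Rabs u.
Proof.
  intros Ha Hb Hu.
  assert (0 <= Rabs u <= a / 2) by (split; [apply Rabs_pos | apply Rabs_le; exact Hu]).
  assert (0 <= a * (a / 2 - Rabs u)) by (apply Rmult_le_pos; lra).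
  destruct (Req_dec (Rabs u) 0) as [E | E]; [rewrite E; nra|].
  assert (0 < b * Rabs u) by (apply Rmult_lt_0_compat; lra). nra.
Qed.

Lemma moebius_bounds (a b u : R) :
  0 < a -> 0 < b -> - (a / 2) <= u <= a / 2 -> - (b / 2) <= moebius a b u <= b / 2.
Proof.
  intros Ha Hb Hu. pose proof (moebius_den a b u Ha Hb Hu) as Hd. unfold moebius.
  assert (0 < b * b) by nra.
  assert (0 <= b * a * (a / 2 - Rabs u)).
  { apply Rmult_le_pos; [nra|]. assert (Rabs u <= a / 2) by (apply Rabs_le; lra). lra. }
  assert (0 <= b / 2 * (a * a + 2 * (b - a) * Rabs u)) by (apply Rmult_le_pos; lra).
  split; [apply Rle_div_r | apply Rle_div_l]; auto;
    unfold Rabs in *; destruct (Rcase_abs u); nra.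
Qed.

Lemma Rdiv_le_cross (x y u v : R) : 0 < u -> 0 < v -> x * v <= y * u -> x / u <= y / v.
Proof.
  intros Hu Hv H. apply Rle_div_l; auto.
  replace (y / v * u) with (y * u / v) by (field; lra). apply Rle_div_r; auto.
Qed.

Lemma moebius_mono (a b u v : R) :
  0 < a -> 0 < b -> - (a / 2) <= u -> u <= v -> v <= a / 2 ->
  moebius a b u <= moebius a b v.
Proof.
  intros Ha Hb Hu Huv Hv.
  assert (Du : 0 < a * a + 2 * (b - a) * Rabs u) by (apply moebius_den; lra).
  assert (Dv : 0 < a * a + 2 * (b - a) * Rabs v) by (apply moebius_den; lra).
  unfold moebius.
  apply Rdiv_le_cross; auto.
  assert (0 < b * b) by nra.
  rewrite !Rmult_assoc. apply Rmult_le_compat_l; [lra|]. apply Rmult_le_compat_l; [lra|].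
  assert (0 <= a * a * (v - u)) by (apply Rmult_le_pos; nra).
  unfold Rabs in *; destruct (Rcase_abs u), (Rcase_abs v); nra.
Qed.

(* In the coordinate [a^2 / u - 2 a] on each half of the interval, [moebius] is the identity. *)
Lemma moebius_cocycle (a b c u : R) :
  0 < a -> 0 < b -> 0 < c -> - (a / 2) <= u <= a / 2 ->
  moebius b c (moebius a b u) = moebius a c u.
Proof.
  intros Ha Hb Hc Hu.
  pose proof (moebius_den a b u Ha Hb Hu) as D1.
  pose proof (moebius_den a c u Ha Hc Hu) as D2.
  pose proof (moebius_den b c _ Hb Hc (moebius_bounds a b u Ha Hb Hu)) as D3.
  assert (E : Rabs (moebius a b u) = b * b * Rabs u / (a * a + 2 * (b - a) * Rabs u)).
  { unfold moebius at 1. unfold Rdiv. rewrite !Rabs_mult, Rabs_inv.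
    rewrite (Rabs_right b), (Rabs_right (_ + _)); lra. }
  unfold moebius at 1. rewrite E in *. unfold moebius.
  field. repeat split; try lra.
  replace (b * b * (a * a + 2 * (b - a) * Rabs u) + 2 * (c - b) * (b * b * Rabs u))
    with (b * b * (a * a + 2 * (c - a) * Rabs u)) by ring.
  assert (0 < b * b) by nra. apply Rgt_not_eq, Rmult_lt_0_compat; auto.
Qed.

Lemma clamp_centered (a y : R) :
  0 < a -> - (a / 2) <= clamp a y - a / 2 <= a / 2.
Proof. intros Ha. pose proof (clamp_bounds a y Ha). lra. Qed.

Lemma phi_bounds (a b y : R) : 0 < a -> 0 < b -> 0 <= phi a b y <= b.
Proof.
  intros Ha Hb.
  pose proof (moebius_bounds a b _ Ha Hb (clamp_centered a y Ha)). unfold phi. lra.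
Qed.

Lemma phi_le0 (a b y : R) : 0 < a -> 0 < b -> y <= 0 -> phi a b y = 0.
Proof.
  intros Ha Hb Hy. unfold phi, moebius. rewrite clamp_le0 by auto.
  rewrite Rabs_left by lra. field. nra.
Qed.

Lemma phi_ge (a b y : R) : 0 < a -> 0 < b -> a <= y -> phi a b y = b.
Proof.
  intros Ha Hb Hy. unfold phi, moebius. rewrite clamp_ge by auto.
  rewrite Rabs_right by lra. field. nra.
Qed.

Lemma phi_mono (a b x y : R) : 0 < a -> 0 < b -> x <= y -> phi a b x <= phi a b y.
Proof.
  intros Ha Hb Hxy. unfold phi. apply Rplus_le_compat_l.
  pose proof (clamp_centered a x Ha). pose proof (clamp_centered a y Ha).
  pose proof (clamp_mono a x y Hxy). apply moebius_mono; lra.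
Qed.

Lemma phi_cocycle (a b c y : R) :
  0 < a -> 0 < b -> 0 < c -> phi b c (phi a b y) = phi a c y.
Proof.
  intros Ha Hb Hc. unfold phi at 1. rewrite clamp_id by (apply phi_bounds; auto).
  unfold phi. replace (b / 2 + moebius a b (clamp a y - a / 2) - b / 2)
    with (moebius a b (clamp a y - a / 2)) by ring.
  rewrite moebius_cocycle; auto using clamp_centered.
Qed.

Lemma phi_id (a y : R) : 0 < a -> phi a a y = clamp a y.
Proof.
  intros Ha. unfold phi, moebius. replace (a - a) with 0 by ring. field. lra.
Qed.

Lemma phi_clamp (a b y : R) : 0 < a -> phi a b (clamp a y) = phi a b y.
Proof.
  intros Ha. unfold phi. rewrite (clamp_id a (clamp a y)); auto using clamp_bounds.
Qed.

(** * The derivative of [phi] minus [clamp] *)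

Definition dphi (a b y : R) : R :=
  (b / (a + (b - a) * Rmin 1 (Rabs (2 * y / a - 1)))) ^ 2.

Lemma dphi_den (a b y : R) : 0 < a -> 0 < b ->
  0 < a + (b - a) * Rmin 1 (Rabs (2 * y / a - 1)).
Proof.
  intros Ha Hb. pose proof (Rabs_pos (2 * y / a - 1)).
  pose proof (Rmin_l 1 (Rabs (2 * y / a - 1))).
  assert (0 <= Rmin 1 (Rabs (2 * y / a - 1))) by (apply Rmin_glb; lra). nra.
Qed.

Lemma is_derive_glue (f f1 f2 : R -> R) (c d r : R) :
  0 < r ->
  (forall x, c - r < x <= c -> f x = f1 x) -> (forall x, c <= x < c + r -> f x = f2 x) ->
  is_derive f1 c d -> is_derive f2 c d -> is_derive f c d.
Proof.
  intros Hr H1 H2 D1 D2. apply is_derive_Reals. apply is_derive_Reals in D1, D2.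
  intros eps He. destruct (D1 eps He) as [e1 K1]. destruct (D2 eps He) as [e2 K2].
  assert (P : 0 < Rmin r (Rmin e1 e2)).
  { apply Rmin_glb_lt; auto. apply Rmin_glb_lt; apply cond_pos. }
  exists (mkposreal _ P). simpl. intros h Hh Hb.
  assert (Rabs h < r /\ Rabs h < e1 /\ Rabs h < e2) as (B0 & B1 & B2).
  { pose proof (Rmin_l r (Rmin e1 e2)). pose proof (Rmin_r r (Rmin e1 e2)).
    pose proof (Rmin_l e1 e2). pose proof (Rmin_r e1 e2). lra. }
  apply Rabs_def2 in B0.
  destruct (Rle_dec h 0).
  - rewrite (H1 (c + h)), (H1 c) by lra. auto.
  - rewrite (H2 (c + h)), (H2 c) by lra. auto.
Qed.

(** Both [phi] and [clamp] have corners at 0 and [a], with the same one-sided slopes 0 and 1, so the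
    corners cancel in the difference. The formulas [f1] to [f4] meet with equal derivatives at 0,
    [a / 2] and [a]. *)
Lemma is_derive_phi (a b y : R) : 0 < a -> 0 < b ->
  is_derive (fun y => phi a b y - clamp a y) y (dphi a b y - 1).
Proof.
  intros Ha Hb.
  set (f := fun y => phi a b y - clamp a y).
  set (f1 := fun y : R => 0).
  set (f2 := fun y => b / 2 + b * b * (y - a / 2) / (a * a + 2 * (b - a) * (a / 2 - y)) - y).
  set (f3 := fun y => b / 2 + b * b * (y - a / 2) / (a * a + 2 * (b - a) * (y - a / 2)) - y).
  set (f4 := fun y : R => b - a).
  assert (E1 : forall y, y <= 0 -> f y = f1 y).
  { intros x Hx. unfold f, f1. rewrite phi_le0, clamp_le0; auto; lra. }
  assert (E2 : forall y, 0 <= y <= a / 2 -> f y = f2 y).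
  { intros x Hx. unfold f, f2, phi, moebius. rewrite clamp_id by lra.
    rewrite Rabs_left1 by lra. replace (- (x - a / 2)) with (a / 2 - x) by ring. reflexivity. }
  assert (E3 : forall y, a / 2 <= y <= a -> f y = f3 y).
  { intros x Hx. unfold f, f3, phi, moebius. rewrite clamp_id by lra.
    rewrite Rabs_right by lra. reflexivity. }
  assert (E4 : forall y, a <= y -> f y = f4 y).
  { intros x Hx. unfold f, f4. rewrite phi_ge, clamp_ge; auto; lra. }
  assert (V : forall y, 2 * y / a - 1 = (y - a / 2) / (a / 2)) by (intros; field; lra).
  assert (Out : forall y, y <= 0 \/ a <= y -> dphi a b y - 1 = 0).
  { intros x Hx. unfold dphi. rewrite Rmin_left.
    - field. lra.
    - rewrite V. unfold Rdiv. rewrite Rabs_mult, Rabs_inv. apply Rle_div_r.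
      + apply Rabs_pos_lt; lra.
      + rewrite Rmult_1_l, (Rabs_right (a * / 2)) by lra.
        unfold Rabs; destruct (Rcase_abs (x - a * / 2)); lra. }
  assert (D1 : forall y, y <= 0 -> is_derive f1 y (dphi a b y - 1)).
  { intros x Hx. rewrite Out by lra. apply @is_derive_const. }
  assert (D4 : forall y, a <= y -> is_derive f4 y (dphi a b y - 1)).
  { intros x Hx. rewrite Out by lra. apply @is_derive_const. }
  assert (In : forall x, 0 <= x <= a -> Rmin 1 (Rabs (2 * x / a - 1)) = Rabs (x - a / 2) / (a / 2)).
  { intros x Hx. rewrite V. unfold Rdiv at 1. rewrite Rabs_mult, Rabs_inv, (Rabs_right (a / 2)) by lra.
    apply Rmin_right. apply Rle_div_l; [lra|]. unfold Rabs; destruct (Rcase_abs _); lra. }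
  assert (D2 : forall y, 0 <= y <= a / 2 -> is_derive f2 y (dphi a b y - 1)).
  { intros x Hx. assert (P : 0 < a * a + 2 * (b - a) * (a / 2 - x)).
    { pose proof (moebius_den a b (a / 2 - x) Ha Hb) as Q. rewrite Rabs_right in Q by lra. apply Q; lra. }
    unfold f2. auto_derive; [apply Rgt_not_eq, P|].
    unfold dphi. rewrite In by lra. rewrite Rabs_left1 by lra. field. split; nra. }
  assert (D3 : forall y, a / 2 <= y <= a -> is_derive f3 y (dphi a b y - 1)).
  { intros x Hx. assert (P : 0 < a * a + 2 * (b - a) * (x - a / 2)).
    { pose proof (moebius_den a b (x - a / 2) Ha Hb) as Q. rewrite Rabs_right in Q by lra. apply Q; lra. }
    unfold f3. auto_derive; [apply Rgt_not_eq, P|].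
    unfold dphi. rewrite In by lra. rewrite Rabs_right by lra. field. split; nra. }
  destruct (Rtotal_order y 0) as [H | [H | H]].
  { apply (is_derive_glue f f1 f1 y _ (- y)); try (intros; apply E1); try apply D1; lra. }
  { apply (is_derive_glue f f1 f2 y _ (a / 2)); try (intros; apply E1); try (intros; apply E2);
      try apply D1; try apply D2; lra. }
  destruct (Rtotal_order y (a / 2)) as [H' | [H' | H']].
  { apply (is_derive_glue f f2 f2 y _ (Rmin y (a / 2 - y))); try apply D2; try lra;
      try (apply Rmin_glb_lt; lra);
      intros; pose proof (Rmin_l y (a / 2 - y)); pose proof (Rmin_r y (a / 2 - y)); apply E2; lra. }
  { apply (is_derive_glue f f2 f3 y _ (a / 2)); try (intros; apply E2); try (intros; apply E3);
      try apply D2; try apply D3; lra. }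
  destruct (Rtotal_order y a) as [H'' | [H'' | H'']].
  { apply (is_derive_glue f f3 f3 y _ (Rmin (y - a / 2) (a - y))); try apply D3; try lra;
      try (apply Rmin_glb_lt; lra);
      intros; pose proof (Rmin_l (y - a / 2) (a - y)); pose proof (Rmin_r (y - a / 2) (a - y)); apply E3; lra. }
  { apply (is_derive_glue f f3 f4 y _ (a / 2)); try (intros; apply E3); try (intros; apply E4);
      try apply D3; try apply D4; lra. }
  { apply (is_derive_glue f f4 f4 y _ (y - a)); try (intros; apply E4); try apply D4; lra. }
Qed.

Lemma continuous_dphi (a b y : R) : 0 < a -> 0 < b -> continuous (dphi a b) y.
Proof.
  intros Ha Hb. apply continuity_pt_filterlim. unfold dphi.
  assert (C : continuity_pt (fun y => Rmin 1 (Rabs (2 * y / a - 1))) y).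
  { assert (forall z, Rmin 1 z = (1 + z - Rabs (1 - z)) / 2) as E.
    { intros z. unfold Rmin, Rabs. destruct (Rle_dec 1 z), (Rcase_abs (1 - z)); lra. }
    apply continuity_pt_ext with
      (fun y => (1 + Rabs (2 * y / a - 1) - Rabs (1 - Rabs (2 * y / a - 1))) / 2).
    { intros t. symmetry. apply E. }
    assert (CA : forall t, continuity_pt Rabs t) by (intros; apply Rcontinuity_abs).
    assert (C1 : continuity_pt (fun y => Rabs (2 * y / a - 1)) y).
    { apply (continuity_pt_comp (fun y => 2 * y / a - 1) Rabs); auto. unfold Rdiv. reg. }
    assert (C2 : continuity_pt (fun y => Rabs (1 - Rabs (2 * y / a - 1))) y).
    { apply (continuity_pt_comp (fun y => 1 - Rabs (2 * y / a - 1)) Rabs); auto.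
      apply continuity_pt_minus; auto. reg. }
    unfold Rdiv at 1. apply continuity_pt_mult; [|reg].
    apply continuity_pt_minus; auto. apply continuity_pt_plus; auto. reg. }
  simpl.
  assert (C' : continuity_pt (fun y => b / (a + (b - a) * Rmin 1 (Rabs (2 * y / a - 1)))) y).
  { apply continuity_pt_div; [reg | | apply Rgt_not_eq, dphi_den; auto].
    apply continuity_pt_plus; [reg|]. apply continuity_pt_mult; [reg | apply C]. }
  apply continuity_pt_mult; [exact C'|]. apply continuity_pt_mult; [exact C' | reg].
Qed.

Definition near (e a b : R) : Prop := a <= (1 + e) * b /\ b <= (1 + e) * a.

(** The denominator is the convex combination [(1 - t) * a + t * b], so [q] lies between [b / a] and
    1; squaring turns [e] into at most [3 * e] because [e <= 1]. *)
Lemma dphi_near (a b e y : R) : 0 < a -> 0 < b -> 0 <= e <= 1 -> near e a b ->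
  Rabs (dphi a b y - 1) <= 3 * e.
Proof.
  intros Ha Hb He [N1 N2]. pose proof (dphi_den a b y Ha Hb) as Hd. unfold dphi.
  pose proof (Rmin_l 1 (Rabs (2 * y / a - 1))) as T1.
  assert (T0 : 0 <= Rmin 1 (Rabs (2 * y / a - 1))) by (apply Rmin_glb; [lra | apply Rabs_pos]).
  set (t := Rmin 1 (Rabs (2 * y / a - 1))) in *.
  set (q := b / (a + (b - a) * t)).
  assert (Q1 : q <= 1 + e).
  { apply Rle_div_l; auto.
    assert (0 <= ((1 + e) * a - b) * (1 - t)) by (apply Rmult_le_pos; lra).
    assert (0 <= e * (b * t)) by (repeat apply Rmult_le_pos; lra). nra. }
  assert (Q2 : 1 - e <= q).
  { apply Rle_div_r; auto.
    assert (a * (1 - e) <= b).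
    { apply Rle_trans with ((1 + e) * b * (1 - e)).
      - apply Rmult_le_compat_r; lra.
      - assert (0 <= e * e * b) by (repeat apply Rmult_le_pos; lra). lra. }
    assert (0 <= (b - (1 - e) * a) * (1 - t)) by (apply Rmult_le_pos; lra).
    assert (0 <= e * (b * t)) by (repeat apply Rmult_le_pos; lra). lra. }
  assert (0 < q) by (apply Rdiv_lt_0_compat; auto).
  apply Rabs_le. simpl. nra.
Qed.

(** Mean value theorem. The bound uses the increment of [clamp] and not [y - x], because for points
    of [[0,1]] these increments, taken over all intervals, add up to [y - x]. *)
Lemma phi_increment (a b e x y : R) : 0 < a -> 0 < b -> 0 <= e <= 1 -> near e a b -> x <= y ->
  Rabs ((phi a b y - clamp a y) - (phi a b x - clamp a x)) <= 3 * e * (clamp a y - clamp a x).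
Proof.
  intros Ha Hb He N Hxy.
  set (f := fun y => phi a b y - clamp a y).
  assert (F : forall y, f y = f (clamp a y)).
  { intros z. unfold f. rewrite phi_clamp, (clamp_id a (clamp a z)); auto using clamp_bounds. }
  change (Rabs (f y - f x) <= 3 * e * (clamp a y - clamp a x)). rewrite (F y), (F x).
  pose proof (clamp_mono a x y Hxy) as Hc.
  destruct (MVT_gen f (clamp a x) (clamp a y) (fun y => dphi a b y - 1)) as [c [_ ->]].
  - intros z _. apply is_derive_phi; auto.
  - intros z _. apply continuity_pt_filterlim, @ex_derive_continuous.
    eexists. apply is_derive_phi; auto.
  - rewrite Rabs_mult, (Rabs_right (clamp a y - clamp a x)) by lra.
    apply Rmult_le_compat_r; [lra | apply dphi_near; auto].
Qed.

(** * Finite sums and series of nonnegative terms *)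

Fixpoint lsum {T : Type} (f : T -> R) (L : list T) : R :=
  match L with
  | nil => 0
  | x :: L => f x + lsum f L
  end.

Lemma lsum_app {T : Type} (f : T -> R) (L L' : list T) :
  lsum f (L ++ L') = lsum f L + lsum f L'.
Proof. induction L; simpl; lra. Qed.

Lemma lsum_map {S T : Type} (f : T -> R) (g : S -> T) (L : list S) :
  lsum f (map g L) = lsum (fun x => f (g x)) L.
Proof. induction L; simpl; lra. Qed.

Lemma lsum_nonneg {T : Type} (f : T -> R) (L : list T) :
  (forall x, 0 <= f x) -> 0 <= lsum f L.
Proof. intros H. induction L as [|x L IH]; simpl; [lra | specialize (H x); lra]. Qed.

Lemma lsum_le {T : Type} (f g : T -> R) (L : list T) :
  (forall x, In x L -> f x <= g x) -> lsum f L <= lsum g L.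
Proof.
  induction L as [|x L IH]; simpl; intros H; [lra|].
  apply Rplus_le_compat; auto.
Qed.

Lemma lsum_scal {T : Type} (c : R) (f : T -> R) (L : list T) :
  lsum (fun x => c * f x) L = c * lsum f L.
Proof. induction L; simpl; lra. Qed.

Lemma lsum_incl {T : Type} (f : T -> R) (L L' : list T) :
  (forall x, 0 <= f x) -> NoDup L -> incl L L' -> lsum f L <= lsum f L'.
Proof.
  intros Hf. revert L'. induction L as [|x L IH]; intros L' HL HI; simpl.
  - apply lsum_nonneg, Hf.
  - inversion_clear HL as [|? ? Hx HN].
    destruct (in_split x L') as (L1 & L2 & ->); [apply HI; left; auto|].
    assert (lsum f L <= lsum f (L1 ++ L2)).
    { apply IH; auto. intros y Hy.
      assert (K : In y (L1 ++ x :: L2)) by (apply HI; right; auto).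
      apply in_app_or in K. apply in_or_app. destruct K as [K | [-> | K]]; tauto. }
    rewrite lsum_app in *. simpl. lra.
Qed.

Lemma sum_n_lsum (a : nat -> R) (N : nat) : sum_n a N = lsum a (seq 0 (S N)).
Proof.
  induction N.
  - rewrite sum_O. simpl. lra.
  - rewrite sum_Sn, IHN, (seq_S (S N) 0), lsum_app. unfold plus; simpl. lra.
Qed.

Lemma ex_series_bounded (a : nat -> R) (M : R) :
  (forall n, 0 <= a n) -> (forall N, sum_n a N <= M) -> ex_series a.
Proof.
  intros Ha HM. destruct (ex_finite_lim_seq_incr (sum_n a) M) as [s Hs]; auto.
  - intros n. rewrite sum_Sn. unfold plus; simpl. specialize (Ha (S n)). lra.
  - exists s. exact Hs.
Qed.

Lemma Series_bounded (a : nat -> R) (M : R) :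
  ex_series a -> (forall N, sum_n a N <= M) -> Series a <= M.
Proof.
  intros Ha HM. apply Series_correct in Ha.
  change (is_lim_seq (sum_n a) (Series a)) in Ha.
  exact (is_lim_seq_le (sum_n a) (fun _ => M) _ _ HM Ha (is_lim_seq_const M)).
Qed.

Lemma ex_series_dom (a b : nat -> R) :
  ex_series b -> (forall n, 0 <= a n <= b n) -> ex_series a.
Proof.
  intros Hb H. apply (@ex_series_le R_AbsRing R_CompleteNormedModule a b); auto.
  intros n. specialize (H n). change (Rabs (a n) <= b n). rewrite Rabs_right; lra.
Qed.

Lemma Series_zero (a : nat -> R) : (forall n, a n = 0) -> Series a = 0.
Proof.
  intros H. rewrite (Series_ext a (fun n => 0 * 0)), Series_scal_l by (intros; rewrite H; ring).
  ring.
Qed.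

Lemma Series_nonneg (a : nat -> R) : ex_series a -> (forall n, 0 <= a n) -> 0 <= Series a.
Proof.
  intros Ha H. rewrite <- (Series_zero (fun _ => 0)) by auto.
  apply Series_le; auto. intros n; split; auto; lra.
Qed.

Lemma sum_n_le_Series (a b : nat -> R) (N : nat) :
  ex_series b -> (forall n, 0 <= b n) -> (forall n, (n <= N)%nat -> a n <= b n) ->
  sum_n a N <= Series b.
Proof.
  intros Eb Hb Hab. rewrite (Series_incr_n b (S N)) by (auto; lia). simpl pred.
  rewrite <- sum_n_Reals.
  assert (0 <= Series (fun k => b (S N + k)%nat)).
  { apply Series_nonneg; auto. apply -> (ex_series_incr_n b (S N)); auto. }
  assert (sum_n a N <= sum_n b N); [|lra].
  rewrite !sum_n_lsum. apply lsum_le. intros n Hn. apply in_seq in Hn. apply Hab. lia.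
Qed.

Lemma Series_tail_bound (a b : nat -> R) (e : R) (N : nat) :
  0 <= e -> ex_series b -> (forall n, 0 <= b n) -> ex_series a ->
  (forall n, (N < n)%nat -> Rabs (a n) <= e * b n) ->
  Rabs (Series a - sum_n a N) <= e * Series b.
Proof.
  intros He Eb Hb Ea H.
  assert (Eb' : ex_series (fun k => b (S N + k)%nat)) by (apply -> (ex_series_incr_n b (S N)); auto).
  rewrite (Series_incr_n a (S N)), (Series_incr_n b (S N)) by (auto; lia). simpl pred.
  rewrite <- !sum_n_Reals.
  replace (sum_n a N + Series (fun k => a (S N + k)%nat) - sum_n a N)
    with (Series (fun k => a (S N + k)%nat)) by ring.
  assert (0 <= sum_n b N) by (rewrite sum_n_lsum; apply lsum_nonneg; auto).
  assert (Ee : ex_series (fun k => e * b (S N + k)%nat))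
    by exact (@ex_series_scal R_AbsRing R_NormedModule e _ Eb').
  assert (B : forall k, 0 <= Rabs (a (S N + k)%nat) <= e * b (S N + k)%nat).
  { intros k. split; [apply Rabs_pos | apply H; lia]. }
  apply Rle_trans with (Series (fun k => Rabs (a (S N + k)%nat))).
  - apply Series_Rabs, (ex_series_dom _ _ Ee B).
  - apply Rle_trans with (e * Series (fun k => b (S N + k)%nat)).
    + rewrite <- Series_scal_l. apply Series_le; auto.
    + apply Rmult_le_compat_l; lra.
Qed.

Lemma Series_abs_bound (a b : nat -> R) (e : R) :
  0 <= e -> ex_series b -> (forall n, 0 <= b n) ->
  (forall n, Rabs (a n) <= e * b n) -> Rabs (Series a) <= e * Series b.
Proof.
  intros He Eb Hb H.
  assert (Ee : ex_series (fun k => e * b k))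
    by exact (@ex_series_scal R_AbsRing R_NormedModule e _ Eb).
  assert (B : forall k, 0 <= Rabs (a k) <= e * b k) by (split; [apply Rabs_pos | auto]).
  rewrite <- Series_scal_l.
  apply Rle_trans with (Series (fun k => Rabs (a k))); [|apply Series_le; auto].
  apply Series_Rabs, (ex_series_dom _ _ Ee B).
Qed.

Lemma is_series_delta (n : nat) (c : R) : is_series (fun m => if (m =? n)%nat then c else 0) c.
Proof.
  assert (H : forall N, sum_n (fun m => if (m =? n)%nat then c else 0) N
                  = if (n <=? N)%nat then c else 0).
  { induction N.
    - rewrite sum_O. destruct n; reflexivity.
    - rewrite sum_Sn, IHN. match goal with |- plus ?x ?y = ?z => change (x + y = z) end.
      destruct (Nat.leb_spec n N), (Nat.leb_spec n (S N)), (Nat.eqb_spec (S N) n);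
        try lia; lra. }
  change (is_lim_seq (sum_n (fun m => if (m =? n)%nat then c else 0)) c).
  apply (is_lim_seq_ext_loc (fun _ => c)).
  - exists n. intros N HN. rewrite H. apply Nat.leb_le in HN. rewrite HN. reflexivity.
  - apply is_lim_seq_const.
Qed.

Definition inverse_maps (s t : nat -> nat) : Prop :=
  (forall n, s (t n) = n) /\ (forall n, t (s n) = n).

Lemma sum_n_perm_le (a : nat -> R) (s t : nat -> nat) (N : nat) :
  inverse_maps s t -> (forall n, 0 <= a n) -> ex_series a ->
  sum_n (fun n => a (s n)) N <= Series a.
Proof.
  intros [_ Ht] Ha Ea. set (M := list_max (map s (seq 0 (S N)))).
  apply Rle_trans with (sum_n a M).
  - rewrite !sum_n_lsum, <- (lsum_map a s). apply lsum_incl; auto.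
    + apply Injective_map_NoDup; [|apply seq_NoDup].
      intros x y E. rewrite <- (Ht x), <- (Ht y), E. reflexivity.
    + intros x Hx. apply in_seq. split; [lia|].
      assert (K : (list_max (map s (seq 0 (S N))) <= M)%nat) by (unfold M; lia).
      apply list_max_le in K. rewrite Forall_forall in K. specialize (K x Hx). lia.
  - apply sum_n_le_Series; auto; intros; lra.
Qed.

Lemma Series_perm (a : nat -> R) (s t : nat -> nat) :
  inverse_maps s t -> (forall n, 0 <= a n) -> ex_series a ->
  ex_series (fun n => a (s n)) /\ Series (fun n => a (s n)) = Series a.
Proof.
  intros Hs Ha Ea.
  assert (E : ex_series (fun n => a (s n))).
  { apply ex_series_bounded with (Series a); auto.
    intros N. apply sum_n_perm_le with t; auto. }
  split; auto. apply Rle_antisym.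
  - apply Series_bounded; auto. intros N. apply sum_n_perm_le with t; auto.
  - apply Series_bounded; auto. intros N.
    assert (Hs' : inverse_maps t s) by (destruct Hs; split; auto).
    pose proof (sum_n_perm_le (fun n => a (s n)) t s N Hs' (fun n => Ha (s n)) E) as K.
    rewrite (sum_n_ext _ a) in K; auto. intros n. f_equal. apply Hs.
Qed.

(** * Adjacent intervals indexed by a total order *)

Definition strict_order (lt : nat -> nat -> bool) : Prop :=
  (forall n, lt n n = false) /\
  (forall m n k, lt m n = true -> lt n k = true -> lt m k = true) /\
  (forall m n, m = n \/ lt m n = true \/ lt n m = true).

Definition weight (l : nat -> R) : Prop := (forall n, 0 < l n) /\ is_series l 1.

(** The order may be dense, without a next interval, so end points cannot be computed one after the
    other. *)
Definition left_end (lt : nat -> nat -> bool) (l : nat -> R) (n : nat) : R :=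
  Series (fun m => if lt m n then l m else 0).

(** An interval to the left of [x] contributes its whole new length and one to the right contributes
    0. Thus the interval containing [x] need not be found, and [x] may lie in none. *)
Definition Phi (lt : nat -> nat -> bool) (l l' : nat -> R) (x : R) : R :=
  Series (fun n => phi (l n) (l' n) (x - left_end lt l n)).

Lemma weight_ex (l : nat -> R) : weight l -> ex_series l.
Proof. intros [_ H]. exists 1. exact H. Qed.

Lemma weight_Series (l : nat -> R) : weight l -> Series l = 1.
Proof. intros [_ H]. apply is_series_unique, H. Qed.

Lemma ex_series_indicator (P : nat -> bool) (l : nat -> R) :
  weight l -> ex_series (fun m => if P m then l m else 0).
Proof.
  intros Hl. apply (ex_series_dom _ l); [apply weight_ex, Hl|].
  intros n. destruct Hl as [Hl _]. specialize (Hl n). destruct (P n); lra.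
Qed.

(** With an end point written as one series, inequalities between end points become termwise
    comparisons. *)
Lemma left_end_plus (lt : nat -> nat -> bool) (l : nat -> R) (n : nat) (c : R) :
  weight l ->
  is_series (fun m => (if lt m n then l m else 0) + (if (m =? n)%nat then c else 0))
    (left_end lt l n + c).
Proof.
  intros Hl.
  apply (is_series_plus (fun m => if lt m n then l m else 0)
           (fun m => if (m =? n)%nat then c else 0)).
  - apply Series_correct, ex_series_indicator, Hl.
  - apply is_series_delta.
Qed.

Lemma left_end_plus_le (lt : nat -> nat -> bool) (l b : nat -> R) (n : nat) (c : R) :
  weight l -> 0 <= c -> ex_series b ->
  (forall m, (if lt m n then l m else 0) + (if (m =? n)%nat then c else 0) <= b m) ->
  left_end lt l n + c <= Series b.
Proof.
  intros Hl Hc Hb H. rewrite <- (is_series_unique _ _ (left_end_plus lt l n c Hl)).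
  apply Series_le; auto. intros m. split; auto.
  destruct Hl as [Hl _]. specialize (Hl m). destruct (lt m n), (m =? n)%nat; lra.
Qed.

Lemma left_end_nonneg (lt : nat -> nat -> bool) (l : nat -> R) (n : nat) :
  weight l -> 0 <= left_end lt l n.
Proof.
  intros Hl. apply Series_nonneg; [apply ex_series_indicator, Hl|].
  intros m. destruct Hl as [Hl _]. specialize (Hl m). destruct (lt m n); lra.
Qed.

Lemma left_end_lt (lt : nat -> nat -> bool) (l : nat -> R) (m n : nat) :
  strict_order lt -> weight l -> lt m n = true -> left_end lt l m + l m <= left_end lt l n.
Proof.
  intros (Oi & Ot & _) Hl Hmn. pose proof Hl as [Hp _].
  apply left_end_plus_le; auto using ex_series_indicator, Rlt_le.
  intros k. pose proof (Hp k). destruct (Nat.eqb_spec k m) as [-> | _].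
  - rewrite Oi, Hmn. lra.
  - destruct (lt k m) eqn:E; [rewrite (Ot _ _ _ E Hmn); lra | destruct (lt k n); lra].
Qed.

Lemma left_end_le1 (lt : nat -> nat -> bool) (l : nat -> R) (n : nat) :
  strict_order lt -> weight l -> left_end lt l n + l n <= 1.
Proof.
  intros (Oi & _ & _) Hl. pose proof Hl as [Hp _]. rewrite <- (weight_Series l Hl).
  apply left_end_plus_le; auto using weight_ex, Rlt_le.
  intros k. pose proof (Hp k). destruct (Nat.eqb_spec k n) as [-> | _].
  - rewrite Oi. lra.
  - destruct (lt k n); lra.
Qed.

Lemma left_end_inj (lt : nat -> nat -> bool) (l : nat -> R) (m n : nat) :
  strict_order lt -> weight l -> left_end lt l m = left_end lt l n -> m = n.
Proof.
  intros Ho Hl E. pose proof Hl as [Hp _].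
  pose proof Ho as (_ & _ & Otot). destruct (Otot m n) as [| [H | H]]; auto;
    apply (left_end_lt lt l _ _ Ho Hl) in H; pose proof (Hp m); pose proof (Hp n); lra.
Qed.

(** Reversing the order reflects [[0,1]], which turns upper bounds on the covered length into lower
    bounds. *)
Definition flip_order (lt : nat -> nat -> bool) (m n : nat) : bool := lt n m.

Lemma strict_order_flip (lt : nat -> nat -> bool) :
  strict_order lt -> strict_order (flip_order lt).
Proof.
  intros (Oi & Ot & Otot). unfold flip_order. split; [|split]; auto.
  - intros m n k H1 H2. exact (Ot _ _ _ H2 H1).
  - intros m n. destruct (Otot m n) as [| []]; auto.
Qed.

Lemma left_end_flip (lt : nat -> nat -> bool) (l : nat -> R) (n : nat) :
  strict_order lt -> weight l -> left_end (flip_order lt) l n = 1 - left_end lt l n - l n.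
Proof.
  intros (Oi & Ot & Otot) Hl.
  assert (E : left_end (flip_order lt) l n + (left_end lt l n + l n) = 1).
  { rewrite <- (weight_Series l Hl), <- (is_series_unique _ _ (left_end_plus lt l n (l n) Hl)).
    unfold left_end. rewrite <- Series_plus.
    - apply Series_ext. intros m. unfold flip_order.
      destruct (Nat.eqb_spec m n) as [-> | D]; [rewrite Oi; lra|].
      destruct (Otot m n) as [| [H | H]]; [contradiction | |]; rewrite H.
      + destruct (lt n m) eqn:H'; [|lra].
        pose proof (Ot _ _ _ H H') as K. rewrite Oi in K. discriminate.
      + destruct (lt m n) eqn:H'; [|lra].
        pose proof (Ot _ _ _ H H') as K. rewrite Oi in K. discriminate.
    - apply ex_series_indicator, Hl.
    - eexists. apply left_end_plus, Hl. }
  lra.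
Qed.

Lemma exists_maximal (lt : nat -> nat -> bool) (P : nat -> Prop) (N : nat) :
  strict_order lt -> (forall n, P n \/ ~ P n) ->
  (forall n, (n <= N)%nat -> ~ P n) \/
  (exists n, P n /\ forall m, (m <= N)%nat -> P m -> m = n \/ lt m n = true).
Proof.
  intros (Oi & Ot & Otot) HP. induction N as [|N IH].
  - destruct (HP 0%nat) as [H | H].
    + right. exists 0%nat. split; auto. intros m Hm _. left. lia.
    + left. intros n Hn. replace n with 0%nat by lia. auto.
  - assert (C : forall m, (m <= S N)%nat -> m = S N \/ (m <= N)%nat) by (intros; lia).
    destruct (HP (S N)) as [H | H], IH as [IH | (n & Hn & IH)].
    + right. exists (S N). split; auto. intros m Hm Pm.
      destruct (C m Hm) as [| D]; auto. exfalso; exact (IH m D Pm).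
    + destruct (Otot (S N) n) as [K | [K | K]].
      * right. exists n. split; auto. intros m Hm Pm.
        destruct (C m Hm) as [-> |]; auto.
      * right. exists n. split; auto. intros m Hm Pm.
        destruct (C m Hm) as [-> |]; auto.
      * right. exists (S N). split; auto. intros m Hm Pm.
        destruct (C m Hm) as [| D]; auto. right.
        destruct (IH m D Pm) as [-> |]; auto. apply Ot with n; auto.
    + left. intros m Hm. destruct (C m Hm) as [-> |]; auto.
    + right. exists n. split; auto. intros m Hm Pm.
      destruct (C m Hm) as [-> |]; auto; contradiction.
Qed.

Lemma ex_series_clamp (lt : nat -> nat -> bool) (l : nat -> R) (x : R) :
  weight l -> ex_series (fun n => clamp (l n) (x - left_end lt l n)).
Proof.
  intros Hl. apply (ex_series_dom _ l); [apply weight_ex, Hl|].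
  intros n. apply clamp_bounds, Hl.
Qed.

(* Beyond the last interval of a finite family that starts before [x], nothing contributes. *)
Lemma Series_clamp_le (lt : nat -> nat -> bool) (l : nat -> R) (x : R) :
  strict_order lt -> weight l -> 0 <= x ->
  Series (fun n => clamp (l n) (x - left_end lt l n)) <= x.
Proof.
  intros Ho Hl Hx. pose proof Hl as [Hp _].
  apply Series_bounded; [apply ex_series_clamp, Hl|]. intros N.
  destruct (exists_maximal lt (fun n => left_end lt l n < x) N Ho) as [H | (n & Hn & H)].
  - intros n. lra.
  - rewrite (sum_n_ext_loc _ (fun _ => 0)).
    + rewrite sum_n_const. lra.
    + intros n Hn. apply clamp_le0; auto. specialize (H n Hn). simpl in H. lra.
  - set (c := clamp (l n) (x - left_end lt l n)).
    assert (Hc : 0 <= c <= x - left_end lt l n).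
    { unfold c, clamp. pose proof (Hp n). unfold Rmax, Rmin.
      destruct (Rle_dec (l n) _), (Rle_dec 0 _); lra. }
    pose proof (left_end_plus lt l n c Hl) as PS.
    apply Rle_trans with (left_end lt l n + c); [|lra].
    rewrite <- (is_series_unique _ _ PS).
    apply sum_n_le_Series; [eexists; apply PS | |].
    + intros m. pose proof (Hp m). destruct (lt m n), (m =? n)%nat; lra.
    + intros m Hm. pose proof (Hp m) as Pm.
      destruct (Rlt_dec (left_end lt l m) x) as [D | D].
      * destruct (H m Hm D) as [-> | K].
        -- rewrite (proj1 Ho), Nat.eqb_refl. fold c. lra.
        -- rewrite K. pose proof (clamp_bounds (l m) (x - left_end lt l m) Pm).
           destruct (m =? n)%nat; lra.
      * rewrite clamp_le0 by lra. destruct (lt m n), (m =? n)%nat; lra.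
Qed.

Lemma clamp_flip (a y : R) : 0 < a -> clamp a (a - y) = a - clamp a y.
Proof.
  intros Ha. destruct (Rle_dec y 0); [rewrite clamp_ge, clamp_le0; lra|].
  destruct (Rle_dec a y); [rewrite clamp_le0, clamp_ge; lra|].
  rewrite !clamp_id; lra.
Qed.

(** A term is the length of the part of its interval left of [x], so the identity excludes gaps of
    positive length. The lower bound is the upper bound at [1 - x] for the reversed order, since the
    lengths add up to 1. *)
Lemma Series_clamp (lt : nat -> nat -> bool) (l : nat -> R) (x : R) :
  strict_order lt -> weight l -> I01 x ->
  Series (fun n => clamp (l n) (x - left_end lt l n)) = x.
Proof.
  intros Ho Hl Hx. apply Rle_antisym.
  - apply Series_clamp_le; auto. apply Hx.
  - pose proof (Series_clamp_le (flip_order lt) l (1 - x) (strict_order_flip lt Ho) Hl) as H.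
    rewrite (Series_ext _ (fun n => l n - clamp (l n) (x - left_end lt l n))) in H.
    + rewrite Series_minus, weight_Series in H; auto using weight_ex, ex_series_clamp.
      destruct Hx. lra.
    + intros n. rewrite left_end_flip, <- clamp_flip by (auto; apply Hl). f_equal. ring.
Qed.

(** * The map between two subdivisions of [0,1] *)

Lemma ex_series_Phi (lt : nat -> nat -> bool) (l l' : nat -> R) (x : R) :
  weight l -> weight l' -> ex_series (fun n => phi (l n) (l' n) (x - left_end lt l n)).
Proof.
  intros Hl Hl'. apply (ex_series_dom _ l'); [apply weight_ex, Hl'|].
  intros n. apply phi_bounds; [apply Hl | apply Hl'].
Qed.

Lemma Phi_mono (lt : nat -> nat -> bool) (l l' : nat -> R) (x y : R) :
  weight l -> weight l' -> x <= y -> Phi lt l l' x <= Phi lt l l' y.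
Proof.
  intros Hl Hl' Hxy. apply Series_le; [|apply ex_series_Phi; auto].
  intros n. split; [apply phi_bounds | apply phi_mono]; try apply Hl; try apply Hl'. lra.
Qed.

Lemma Phi_0 (lt : nat -> nat -> bool) (l l' : nat -> R) :
  weight l -> weight l' -> Phi lt l l' 0 = 0.
Proof.
  intros Hl Hl'. apply Series_zero. intros n.
  apply phi_le0; [apply Hl | apply Hl' |]. pose proof (left_end_nonneg lt l n Hl). lra.
Qed.

Lemma Phi_1 (lt : nat -> nat -> bool) (l l' : nat -> R) :
  strict_order lt -> weight l -> weight l' -> Phi lt l l' 1 = 1.
Proof.
  intros Ho Hl Hl'. rewrite <- (weight_Series l' Hl') at 2. apply Series_ext. intros n.
  apply phi_ge; [apply Hl | apply Hl' |]. pose proof (left_end_le1 lt l n Ho Hl). lra.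
Qed.

Lemma Phi_I01 (lt : nat -> nat -> bool) (l l' : nat -> R) (x : R) :
  strict_order lt -> weight l -> weight l' -> I01 x -> I01 (Phi lt l l' x).
Proof.
  intros Ho Hl Hl' [H0 H1]. split.
  - rewrite <- (Phi_0 lt l l'); auto. apply Phi_mono; auto.
  - rewrite <- (Phi_1 lt l l'); auto. apply Phi_mono; auto.
Qed.

Lemma Phi_interval (lt : nat -> nat -> bool) (l l' : nat -> R) (n : nat) (y : R) :
  strict_order lt -> weight l -> weight l' -> 0 <= y <= l n ->
  Phi lt l l' (left_end lt l n + y) = left_end lt l' n + phi (l n) (l' n) y.
Proof.
  intros Ho Hl Hl' Hy. pose proof Ho as (Oi & Ot & Otot).
  rewrite <- (is_series_unique _ _ (left_end_plus lt l' n (phi (l n) (l' n) y) Hl')).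
  apply Series_ext. intros m. destruct (Nat.eqb_spec m n) as [-> | D].
  - rewrite Oi, Rplus_0_l. f_equal. ring.
  - destruct (Otot m n) as [| [H | H]]; [contradiction | |].
    + rewrite H, Rplus_0_r. apply phi_ge; [apply Hl | apply Hl' |].
      pose proof (left_end_lt lt l m n Ho Hl H). lra.
    + destruct (lt m n) eqn:H'.
      { pose proof (Ot _ _ _ H H') as K. rewrite Oi in K. discriminate. }
      rewrite Rplus_0_l. apply phi_le0; [apply Hl | apply Hl' |].
      pose proof (left_end_lt lt l n m Ho Hl H). lra.
Qed.

Lemma Phi_left_end (lt : nat -> nat -> bool) (l l' : nat -> R) (n : nat) :
  strict_order lt -> weight l -> weight l' -> Phi lt l l' (left_end lt l n) = left_end lt l' n.
Proof.
  intros Ho Hl Hl'. assert (H : 0 < l n) by apply Hl.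
  rewrite <- (Rplus_0_r (left_end lt l n)), Phi_interval; auto; [|lra].
  rewrite phi_le0; auto; [lra | apply Hl' | lra].
Qed.

(** This holds wherever [x] lies, so the cocycle relation for [Phi] can be checked term by term,
    even at points that belong to no interval. *)
Lemma clamp_Phi (lt : nat -> nat -> bool) (l l' : nat -> R) (n : nat) (x : R) :
  strict_order lt -> weight l -> weight l' ->
  clamp (l' n) (Phi lt l l' x - left_end lt l' n) = phi (l n) (l' n) (x - left_end lt l n).
Proof.
  intros Ho Hl Hl'. assert (H : 0 < l n) by apply Hl. assert (H' : 0 < l' n) by apply Hl'.
  destruct (Rle_dec x (left_end lt l n)).
  { rewrite phi_le0 by lra. apply clamp_le0; auto.
    pose proof (Phi_mono lt l l' x (left_end lt l n) Hl Hl') as K. rewrite Phi_left_end in K; auto. lra. }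
  destruct (Rle_dec (left_end lt l n + l n) x).
  { rewrite phi_ge by lra. apply clamp_ge; auto.
    pose proof (Phi_mono lt l l' (left_end lt l n + l n) x Hl Hl') as K.
    rewrite Phi_interval, phi_ge in K; auto; lra. }
  replace x with (left_end lt l n + (x - left_end lt l n)) at 1 by ring.
  rewrite Phi_interval; auto; [|lra].
  pose proof (phi_bounds (l n) (l' n) (x - left_end lt l n) H H').
  rewrite clamp_id; lra.
Qed.

Lemma Phi_cocycle (lt : nat -> nat -> bool) (l l' l'' : nat -> R) (x : R) :
  strict_order lt -> weight l -> weight l' -> weight l'' ->
  Phi lt l' l'' (Phi lt l l' x) = Phi lt l l'' x.
Proof.
  intros Ho Hl Hl' Hl''. apply Series_ext. intros n.
  rewrite <- phi_clamp, clamp_Phi, phi_cocycle; auto; try apply Hl; try apply Hl'; apply Hl''.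
Qed.

Lemma Phi_id (lt : nat -> nat -> bool) (l : nat -> R) (x : R) :
  strict_order lt -> weight l -> I01 x -> Phi lt l l x = x.
Proof.
  intros Ho Hl Hx. rewrite <- (Series_clamp lt l x) at 2; auto.
  apply Series_ext. intros n. apply phi_id, Hl.
Qed.

Lemma Phi_inv01 (lt : nat -> nat -> bool) (l l' : nat -> R) :
  strict_order lt -> weight l -> weight l' -> inv01 (Phi lt l l') (Phi lt l' l).
Proof.
  intros Ho Hl Hl'. repeat split; try (apply Phi_I01; assumption);
    intros x Hx; rewrite Phi_cocycle, Phi_id; auto.
Qed.

(** * Order-preserving permutations of the intervals *)

Definition order_perm (lt : nat -> nat -> bool) (s t : nat -> nat) : Prop :=
  inverse_maps s t /\ forall m n, lt (s m) (s n) = lt m n.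

Lemma weight_perm (l : nat -> R) (s t : nat -> nat) :
  inverse_maps s t -> weight l -> weight (fun n => l (s n)).
Proof.
  intros Hs Hl. split; [intros; apply Hl|].
  destruct (Series_perm l s t Hs) as [E1 E2]; auto using weight_ex.
  { intros n. apply Rlt_le, Hl. }
  rewrite <- (weight_Series l Hl), <- E2. apply Series_correct, E1.
Qed.

Lemma left_end_perm (lt : nat -> nat -> bool) (l : nat -> R) (s t : nat -> nat) (n : nat) :
  order_perm lt s t -> weight l -> left_end lt (fun n => l (s n)) n = left_end lt l (s n).
Proof.
  intros [Hs Hlt] Hl. unfold left_end at 2.
  destruct (Series_perm (fun m => if lt m (s n) then l m else 0) s t Hs) as [_ <-].
  - intros m. pose proof (proj1 Hl m). destruct (lt m (s n)); lra.
  - apply (ex_series_indicator (fun m => lt m (s n))), Hl.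
  - apply Series_ext. intros m. rewrite Hlt. reflexivity.
Qed.

(** An order automorphism only renumbers the intervals. Together with the cocycle relation this
    yields the rules for composing and conjugating. *)
Lemma Phi_perm (lt : nat -> nat -> bool) (l l' : nat -> R) (s t : nat -> nat) (x : R) :
  order_perm lt s t -> weight l -> weight l' ->
  Phi lt (fun n => l (s n)) (fun n => l' (s n)) x = Phi lt l l' x.
Proof.
  intros Hs Hl Hl'. unfold Phi at 2.
  destruct (Series_perm (fun n => phi (l n) (l' n) (x - left_end lt l n)) s t (proj1 Hs)) as [_ <-].
  - intros n. apply phi_bounds; [apply Hl | apply Hl'].
  - apply ex_series_Phi; auto.
  - apply Series_ext. intros m. rewrite (left_end_perm lt l s t); auto.
Qed.

(** * Continuous differentiability and C^1 distance to the identity *)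

Definition deriv_at (f : R -> R) (d x : R) : Prop :=
  limit1_in (fun y => (f y - f x) / (y - x)) (fun y => I01 y /\ y <> x) d x.

Lemma I01_near (x r : R) : I01 x -> 0 < r -> exists y, I01 y /\ y <> x /\ Rabs (y - x) < r.
Proof.
  intros [H0 H1] Hr. set (m := Rmin (r / 2) (1 / 2)).
  assert (0 < m) by (apply Rmin_glb_lt; lra).
  assert (m <= r / 2) by apply Rmin_l. assert (m <= 1 / 2) by apply Rmin_r.
  destruct (Rle_dec x (1 / 2)).
  - exists (x + m). repeat split; try lra. rewrite Rabs_right; lra.
  - exists (x - m). repeat split; try lra. rewrite Rabs_left; lra.
Qed.

(** A Lipschitz bound passes to derivatives, one-sided ones at 0 and 1 included. It serves both for
    the uniform convergence of derivatives and for the final closeness to 1. *)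
Lemma deriv_at_bound (f : R -> R) (c d e x : R) :
  I01 x -> deriv_at f d x ->
  (forall y, I01 y -> Rabs (f y - f x - c * (y - x)) <= e * Rabs (y - x)) ->
  Rabs (d - c) <= e.
Proof.
  intros Hx Hd He. apply le_epsilon. intros eta Heta.
  destruct (Hd eta Heta) as (r & Hr & K). destruct (I01_near x r Hx Hr) as (y & Hy & Dy & Ry).
  specialize (K y (conj (conj Hy Dy) Ry)). simpl in K. unfold Rdist in K.
  specialize (He y Hy).
  assert (P : 0 < Rabs (y - x)) by (apply Rabs_pos_lt; lra).
  set (q := (f y - f x) / (y - x)) in *.
  assert (B : Rabs (q - c) <= e).
  { apply Rmult_le_reg_r with (Rabs (y - x)); auto. rewrite <- Rabs_mult.
    replace ((q - c) * (y - x)) with (f y - f x - c * (y - x)); auto.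
    unfold q. field. lra. }
  replace (d - c) with ((q - c) - (q - d)) by ring.
  pose proof (Rabs_triang (q - c) (- (q - d))) as T. rewrite Rabs_Ropp in T.
  unfold Rminus at 1. lra.
Qed.

Lemma is_derive_deriv_at (f : R -> R) (d x : R) : is_derive f x d -> deriv_at f d x.
Proof.
  intros H eps He. apply is_derive_Reals in H. destruct (H eps He) as [r K].
  exists r. split; [apply cond_pos|]. intros y [[_ Dy] Ry]. simpl in *. unfold Rdist in *.
  specialize (K (y - x) ltac:(lra) Ry). replace (x + (y - x)) with y in K by ring. exact K.
Qed.

Lemma Rabs_triang3 (a b c e1 e2 e3 : R) :
  Rabs a <= e1 -> Rabs b <= e2 -> Rabs c <= e3 -> Rabs (a + b + c) <= e1 + e2 + e3.
Proof.
  intros. pose proof (Rabs_triang (a + b) c). pose proof (Rabs_triang a b). lra.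
Qed.

(** The errors [f - S n] tend to 0 in the Lipschitz seminorm. Hence the [E n] are uniformly Cauchy
    on [[0,1]], and their limit is the derivative of [f]. *)
Lemma C1_of_approx (f : R -> R) (S E : nat -> R -> R) :
  (forall n x, is_derive (S n) x (E n x)) -> (forall n x, continuous (E n) x) ->
  (forall eps, 0 < eps -> exists N, forall n, (N <= n)%nat -> forall x y, I01 x -> I01 y ->
     Rabs (f y - f x - (S n y - S n x)) <= eps * Rabs (y - x)) ->
  C1_01 f.
Proof.
  intros HS HE HA.
  assert (Cau : forall eps, 0 < eps -> exists N, forall n m, (N <= n)%nat -> (N <= m)%nat ->
    forall x, I01 x -> Rabs (E n x - E m x) <= 2 * eps).
  { intros eps He. destruct (HA eps He) as [N HN]. exists N. intros n m Hn Hm x Hx.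
    rewrite <- (Rminus_0_r (E n x - E m x)).
    apply (deriv_at_bound (fun y => S n y - S m y) 0 _ _ x Hx).
    - apply is_derive_deriv_at. apply (is_derive_minus (S n) (S m)); apply HS.
    - intros y Hy. pose proof (HN n Hn x y Hx Hy) as K1. pose proof (HN m Hm x y Hx Hy) as K2.
      replace (S n y - S m y - (S n x - S m x) - 0 * (y - x)) with
        ((f y - f x - (S m y - S m x)) + - (f y - f x - (S n y - S n x))) by ring.
      eapply Rle_trans; [apply Rabs_triang|]. rewrite Rabs_Ropp. lra. }
  (* Outside [[0,1]] this is whatever [Lim_seq] returns; only its values on [[0,1]] matter. *)
  set (d := fun x => real (Lim_seq (fun n => E n x))).
  assert (Lim : forall x, I01 x -> is_lim_seq (fun n => E n x) (d x)).
  { intros x Hx. apply Lim_seq_correct'. apply ex_lim_seq_cauchy_corr.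
    intros eps. destruct (Cau (eps / 3)) as [N HN]; [pose proof (cond_pos eps); lra|].
    exists N. intros n m Hn Hm. eapply Rle_lt_trans; [apply HN; auto|].
    pose proof (cond_pos eps). lra. }
  assert (Unif : forall eps, 0 < eps -> exists n,
    (forall x y, I01 x -> I01 y ->
       Rabs (f y - f x - (S n y - S n x)) <= eps * Rabs (y - x)) /\
    forall x, I01 x -> Rabs (E n x - d x) <= 3 * eps).
  { intros eps He. destruct (HA eps He) as [N1 H1]. destruct (Cau eps He) as [N2 H2].
    exists (max N1 N2). split; [intros; apply H1; auto; lia|].
    intros x Hx. specialize (Lim x Hx).
    apply is_lim_seq_spec in Lim. destruct (Lim (mkposreal eps He)) as [N3 H3]. simpl in H3.
    specialize (H3 (max N2 N3) ltac:(lia)).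
    specialize (H2 (max N1 N2) (max N2 N3) ltac:(lia) ltac:(lia) x Hx).
    replace (E (max N1 N2) x - d x) with
      ((E (max N1 N2) x - E (max N2 N3) x) + (E (max N2 N3) x - d x)) by ring.
    eapply Rle_trans; [apply Rabs_triang|]. lra. }
  exists d. split.
  - intros x Hx eps He. destruct (Unif (eps / 8)) as (n & A & B); [lra|].
    destruct (is_derive_deriv_at _ _ _ (HS n x) (eps / 8)) as (r & Hr & K); [lra|].
    exists r. split; auto. intros y Hy. specialize (K y Hy). destruct Hy as [[Hy Dy] Ry].
    simpl in *. unfold Rdist in *. specialize (A x y Hx Hy). specialize (B x Hx).
    replace ((f y - f x) / (y - x) - d x) with
      ((f y - f x - (S n y - S n x)) / (y - x) + ((S n y - S n x) / (y - x) - E n x)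
       + (E n x - d x)) by (field; lra).
    eapply Rle_lt_trans; [apply Rabs_triang3; [| apply Rlt_le, K | apply B]|].
    + instantiate (1 := eps / 8). unfold Rdiv at 1. rewrite Rabs_mult, Rabs_inv.
      apply Rle_div_l; auto. apply Rabs_pos_lt. lra.
    + lra.
  - intros x Hx eps He. destruct (Unif (eps / 8)) as (n & _ & B); [lra|].
    pose proof (HE n x) as C. apply continuity_pt_filterlim in C.
    destruct (C (eps / 8)) as (r & Hr & K); [lra|].
    exists r. split; auto. intros y [Hy Ry]. simpl in *. unfold Rdist in *.
    pose proof (B x Hx) as Bx. pose proof (B y Hy) as By.
    assert (Kxy : Rabs (E n y - E n x) <= eps / 8).
    { destruct (Req_dec y x) as [-> | D].
      - rewrite Rminus_diag, Rabs_R0. lra.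
      - apply Rlt_le, K. split; auto. split; [exact I | auto]. }
    replace (d y - d x) with (- (E n y - d y) + (E n y - E n x) + (E n x - d x)) by ring.
    eapply Rle_lt_trans; [apply Rabs_triang3; [rewrite Rabs_Ropp | |]; eauto|]. lra.
Qed.

Lemma C1_01_ext (f g : R -> R) : (forall x, I01 x -> f x = g x) -> C1_01 f -> C1_01 g.
Proof.
  intros E (d & Hd & Hc). exists d. split; auto. intros x Hx eps He.
  destruct (Hd x Hx eps He) as (r & Hr & K). exists r. split; auto.
  intros y Hy. rewrite <- !E; auto. apply Hy.
Qed.

(** The clamps sum to the identity, so subtracting it replaces summands with corners by continuously
    differentiable ones. *)
Lemma Phi_minus_id (lt : nat -> nat -> bool) (l l' : nat -> R) (x y : R) :
  strict_order lt -> weight l -> weight l' -> I01 x -> I01 y ->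
  is_series (fun n => (phi (l n) (l' n) (y - left_end lt l n) - clamp (l n) (y - left_end lt l n))
    - (phi (l n) (l' n) (x - left_end lt l n) - clamp (l n) (x - left_end lt l n)))
    ((Phi lt l l' y - y) - (Phi lt l l' x - x)).
Proof.
  intros Ho Hl Hl' Hx Hy.
  assert (P : forall z, I01 z -> is_series
    (fun n => phi (l n) (l' n) (z - left_end lt l n) - clamp (l n) (z - left_end lt l n))
    (Phi lt l l' z - z)).
  { intros z Hz. rewrite <- (Series_clamp lt l z) at 2; auto.
    apply (is_series_minus (fun n => phi (l n) (l' n) (z - left_end lt l n))
      (fun n => clamp (l n) (z - left_end lt l n))).
    - apply Series_correct, ex_series_Phi; auto.
    - apply Series_correct, ex_series_clamp; auto. }
  apply (is_series_minus
    (fun n => phi (l n) (l' n) (y - left_end lt l n) - clamp (l n) (y - left_end lt l n))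
    (fun n => phi (l n) (l' n) (x - left_end lt l n) - clamp (l n) (x - left_end lt l n)));
    auto.
Qed.

Lemma is_series_clamp_increment (lt : nat -> nat -> bool) (l : nat -> R) (x y : R) :
  strict_order lt -> weight l -> I01 x -> I01 y ->
  is_series (fun n => clamp (l n) (y - left_end lt l n) - clamp (l n) (x - left_end lt l n)) (y - x).
Proof.
  intros Ho Hl Hx Hy.
  rewrite <- (Series_clamp lt l y) at 1 by auto. rewrite <- (Series_clamp lt l x) at 1 by auto.
  apply (is_series_minus (fun n => clamp (l n) (y - left_end lt l n))
    (fun n => clamp (l n) (x - left_end lt l n)));
  apply Series_correct, ex_series_clamp; auto.
Qed.

Lemma Phi_increment (lt : nat -> nat -> bool) (l l' : nat -> R) (e x y : R) :
  strict_order lt -> weight l -> weight l' -> 0 <= e <= 1 ->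
  (forall n, near e (l n) (l' n)) -> I01 x -> I01 y -> x <= y ->
  Rabs ((Phi lt l l' y - y) - (Phi lt l l' x - x)) <= 3 * e * (y - x).
Proof.
  intros Ho Hl Hl' He Hn Hx Hy Hxy.
  pose proof (is_series_clamp_increment lt l x y Ho Hl Hx Hy) as C.
  rewrite <- (is_series_unique _ _ (Phi_minus_id lt l l' x y Ho Hl Hl' Hx Hy)).
  rewrite <- (is_series_unique _ _ C).
  apply Series_abs_bound; [lra | eexists; apply C | |].
  - intros n. pose proof (clamp_mono (l n) (x - left_end lt l n) (y - left_end lt l n)). lra.
  - intros n. apply phi_increment; auto; try apply Hl; try apply Hl'; lra.
Qed.

(** The identity plus finitely many terms [phi - clamp] is C^1, and the remaining terms together
    have Lipschitz constant at most [3 * e], since only nearly equal lengths are left. *)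
Lemma C1_Phi (lt : nat -> nat -> bool) (l l' : nat -> R) :
  strict_order lt -> weight l -> weight l' ->
  (forall eps, 0 < eps -> exists N, forall n, (N <= n)%nat -> near eps (l n) (l' n)) ->
  C1_01 (Phi lt l l').
Proof.
  intros Ho Hl Hl' Hn.
  set (u := fun n x => phi (l n) (l' n) (x - left_end lt l n) - clamp (l n) (x - left_end lt l n)).
  set (v := fun n x => dphi (l n) (l' n) (x - left_end lt l n) - 1).
  assert (Du : forall n x, is_derive (u n) x (v n x)).
  { intros n x. unfold u, v.
    rewrite <- (Rmult_1_l (dphi (l n) (l' n) (x - left_end lt l n) - 1)).
    apply (is_derive_comp (fun y => phi (l n) (l' n) y - clamp (l n) y)
      (fun x => x - left_end lt l n)).
    - apply is_derive_phi; [apply Hl | apply Hl'].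
    - auto_derive; auto. }
  assert (Cv : forall n x, continuous (v n) x).
  { intros n x. unfold v. apply (continuous_minus (fun x => dphi (l n) (l' n) (x - left_end lt l n)));
      [|apply continuous_const].
    apply (continuous_comp (fun x => x - left_end lt l n) (dphi (l n) (l' n))).
    - apply (@ex_derive_continuous R_AbsRing R_NormedModule). auto_derive; auto.
    - apply continuous_dphi; [apply Hl | apply Hl']. }
  apply C1_of_approx with
    (S := fun N x => x + sum_n (fun n => u n x) N) (E := fun N x => 1 + sum_n (fun n => v n x) N).
  - intros N x. apply (@is_derive_plus R_AbsRing R_NormedModule (fun x => x)
      (fun x => sum_n (fun n => u n x) N) x 1 (sum_n (fun n => v n x) N)).
    { apply @is_derive_id. }
    induction N as [|N IH].
    + apply (is_derive_ext (u 0%nat)); [intros t; symmetry; apply (sum_O (fun n => u n t))|]. rewrite sum_O. apply Du.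
    + apply (is_derive_ext (fun t => plus (sum_n (fun n => u n t) N) (u (S N) t)));
        [intros t; symmetry; apply (sum_Sn (fun n => u n t))|]. rewrite sum_Sn.
      apply (@is_derive_plus R_AbsRing R_NormedModule (fun t => sum_n (fun n => u n t) N)
        (u (S N))); auto.
  - intros N x. apply (@continuous_plus R_UniformSpace R_AbsRing R_NormedModule (fun _ => 1)
      (fun x => sum_n (fun n => v n x) N)); [apply continuous_const|].
    induction N as [|N IH].
    + apply (continuous_ext (v 0%nat)); [intros t; symmetry; apply (sum_O (fun n => v n t))|]. apply Cv.
    + apply (continuous_ext (fun t => plus (sum_n (fun n => v n t) N) (v (S N) t)));
        [intros t; symmetry; apply (sum_Sn (fun n => v n t))|].
      apply (@continuous_plus R_UniformSpace R_AbsRing R_NormedModule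
        (fun t => sum_n (fun n => v n t) N) (v (S N))); auto.
  - intros eps He. set (e := Rmin 1 (eps / 3)).
    assert (He' : 0 < e <= 1) by (split; [apply Rmin_glb_lt; lra | apply Rmin_l]).
    assert (He3 : 3 * e <= eps) by (assert (e <= eps / 3) by apply Rmin_r; lra).
    destruct (Hn e (proj1 He')) as [N HN].
    assert (W : forall n, (N <= n)%nat -> forall x y, I01 x -> I01 y -> x <= y ->
      Rabs (Phi lt l l' y - Phi lt l l' x
        - (y + sum_n (fun k => u k y) n - (x + sum_n (fun k => u k x) n))) <= eps * (y - x)).
    { intros n Hn' x y Hx Hy Hxy.
      pose proof (is_series_clamp_increment lt l x y Ho Hl Hx Hy) as C.
      pose proof (Phi_minus_id lt l l' x y Ho Hl Hl' Hx Hy) as D.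
      change (is_series (fun n => u n y - u n x) (Phi lt l l' y - y - (Phi lt l l' x - x))) in D.
      assert (Sm : sum_n (fun k => u k y - u k x) n
        = sum_n (fun k => u k y) n - sum_n (fun k => u k x) n).
      { clear. induction n as [|n IH]; [rewrite !sum_O; reflexivity|].
        rewrite !sum_Sn, IH. unfold plus; simpl. ring. }
      replace (Phi lt l l' y - Phi lt l l' x
        - (y + sum_n (fun k => u k y) n - (x + sum_n (fun k => u k x) n)))
        with (Phi lt l l' y - y - (Phi lt l l' x - x) - sum_n (fun k => u k y - u k x) n)
        by (rewrite Sm; ring).
      rewrite <- (is_series_unique _ _ D).
      apply Rle_trans with (3 * e * (y - x)); [|apply Rmult_le_compat_r; lra].
      rewrite <- (is_series_unique _ _ C).
      apply Series_tail_bound; [lra | eexists; apply C | | eexists; apply D |].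
      - intros k. pose proof (clamp_mono (l k) (x - left_end lt l k) (y - left_end lt l k)). lra.
      - intros k Hk. apply phi_increment; try apply Hl; try apply Hl'; try lra.
        apply HN. lia. }
    exists N. intros n Hn' x y Hx Hy. destruct (Rle_dec x y) as [L | L].
    + rewrite (Rabs_right (y - x)) by lra. apply W; auto.
    + rewrite (Rabs_left (y - x)), <- Rabs_Ropp by lra.
      replace (- (y - x)) with (x - y) by ring.
      eapply Rle_trans; [|apply (W n Hn' y x Hy Hx); lra].
      right. f_equal. ring.
Qed.

Lemma near_sym (e a b : R) : near e a b -> near e b a.
Proof. intros [H1 H2]. split; auto. Qed.

Lemma Diff1plus_Phi (lt : nat -> nat -> bool) (l l' : nat -> R) :
  strict_order lt -> weight l -> weight l' ->
  (forall eps, 0 < eps -> exists N, forall n, (N <= n)%nat -> near eps (l n) (l' n)) ->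
  Diff1plus (Phi lt l l').
Proof.
  intros Ho Hl Hl' Hn. split; [apply C1_Phi; auto|].
  split; [apply Phi_0; auto|]. split; [apply Phi_1; auto|].
  exists (Phi lt l' l). split; [apply Phi_inv01; auto|].
  apply C1_Phi; auto. intros eps He. destruct (Hn eps He) as [N HN].
  exists N. intros n Hn'. apply near_sym; auto.
Qed.

Lemma Phi_C1_close (lt : nat -> nat -> bool) (l l' : nat -> R) (e : R) (k d : R -> R) :
  strict_order lt -> weight l -> weight l' -> 0 <= e <= 1 ->
  (forall n, near e (l n) (l' n)) ->
  (forall x, I01 x -> k x = Phi lt l l' x) -> is_deriv01 k d ->
  forall x, I01 x -> Rabs (k x - x) <= 3 * e /\ Rabs (d x - 1) <= 3 * e.
Proof.
  intros Ho Hl Hl' He Hn Hk Hd x Hx.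
  assert (Z : I01 0) by (split; lra).
  assert (B : forall y z, I01 y -> I01 z ->
    Rabs ((Phi lt l l' z - z) - (Phi lt l l' y - y)) <= 3 * e * Rabs (z - y)).
  { intros y z Hy Hz. destruct (Rle_dec y z).
    - rewrite (Rabs_right (z - y)) by lra. apply Phi_increment; auto.
    - rewrite (Rabs_left (z - y)), <- Rabs_Ropp by lra.
      eapply Rle_trans; [|eapply Rle_trans; [apply (Phi_increment lt l l' e z y); auto; lra|]].
      + right. f_equal. ring.
      + right. ring. }
  split.
  - specialize (B 0 x Z Hx). rewrite Phi_0 in B; auto. rewrite Hk by auto.
    replace (Phi lt l l' x - x - (0 - 0)) with (Phi lt l l' x - x) in B by ring.
    eapply Rle_trans; [apply B|]. rewrite <- (Rmult_1_r (3 * e)) at 2.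
    apply Rmult_le_compat_l; [lra|]. destruct Hx. apply Rabs_le. lra.
  - apply (deriv_at_bound k 1 (d x) (3 * e) x Hx (Hd x Hx)).
    intros y Hy. rewrite !Hk by auto.
    replace (Phi lt l l' y - Phi lt l l' x - 1 * (y - x)) with
      (Phi lt l l' y - y - (Phi lt l l' x - x)) by ring. auto.
Qed.

(** * Flattening a weight *)

(** The ramp [t * t / tau] meets [t] at [tau] and at most squares ratios, so near values stay near.
    Being quadratic, it exceeds 1 on all values at least [d] as soon as [tau < d * d]. *)
Definition cutoff (K tau t : R) : R := Rmin K (Rmax t (t * t / tau)).

Lemma cutoff_pos (K tau t : R) : 0 < K -> 0 < t -> 0 < cutoff K tau t.
Proof.
  intros HK Ht. apply Rmin_glb_lt; auto. apply Rlt_le_trans with t; auto. apply Rmax_l.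
Qed.

Lemma cutoff_small (K tau t : R) : 0 < t -> t <= tau -> tau <= K -> cutoff K tau t = t.
Proof.
  intros H0 H1 H2. unfold cutoff.
  assert (t * t / tau <= t) by (apply Rle_div_l; [lra | apply Rmult_le_compat_l; lra]).
  rewrite Rmax_left, Rmin_right; auto; lra.
Qed.

Lemma cutoff_min_le (tau t : R) : 0 < tau -> 0 < t -> cutoff tau tau t <= t.
Proof.
  intros H0 H1. destruct (Rle_dec t tau).
  - rewrite cutoff_small; lra.
  - apply Rle_trans with tau; [apply Rmin_l | lra].
Qed.

Lemma cutoff_ge (K tau t : R) : t <= K -> t <= cutoff K tau t.
Proof.
  intros H. apply Rmin_glb; [auto | apply Rmax_l].
Qed.

Lemma cutoff_near1 (K tau t u e : R) : 0 < K -> 0 < tau -> 0 < t -> 0 < u -> 0 <= e <= 1 ->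
  t <= (1 + e) * u -> cutoff K tau t <= (1 + 3 * e) * cutoff K tau u.
Proof.
  intros HK Htau Ht Hu He H. unfold cutoff.
  assert (S : t * t <= (1 + 3 * e) * (u * u)).
  { apply Rle_trans with (((1 + e) * u) * ((1 + e) * u)).
    - apply Rmult_le_compat; lra.
    - assert (0 <= (e - e * e) * (u * u)) by (apply Rmult_le_pos; nra). lra. }
  assert (M : Rmax t (t * t / tau) <= (1 + 3 * e) * Rmax u (u * u / tau)).
  { apply Rmax_lub.
    - apply Rle_trans with ((1 + 3 * e) * u); [nra|].
      apply Rmult_le_compat_l; [lra | apply Rmax_l].
    - apply Rle_trans with ((1 + 3 * e) * (u * u / tau)).
      + replace ((1 + 3 * e) * (u * u / tau)) with ((1 + 3 * e) * (u * u) / tau) by (field; lra).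
        apply Rmult_le_compat_r; auto. apply Rlt_le, Rinv_0_lt_compat, Htau.
      + apply Rmult_le_compat_l; [lra | apply Rmax_r]. }
  apply (Rmin_case K (Rmax u (u * u / tau))
    (fun z => Rmin K (Rmax t (t * t / tau)) <= (1 + 3 * e) * z)).
  - apply Rle_trans with K; [apply Rmin_l | nra].
  - eapply Rle_trans; [apply Rmin_r | apply M].
Qed.

Lemma cutoff_near (K tau t u e : R) : 0 < K -> 0 < tau -> 0 < t -> 0 < u -> 0 <= e <= 1 ->
  near e t u -> near (3 * e) (cutoff K tau t) (cutoff K tau u).
Proof. intros HK Htau Ht Hu He [H1 H2]. split; apply cutoff_near1; auto. Qed.

Lemma continuity_cutoff (tau t : R) : continuity (fun K => cutoff K tau t).
Proof.
  intros K. unfold cutoff. set (c := Rmax t (t * t / tau)).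
  apply continuity_pt_ext with (fun K => (K + c - Rabs (K - c)) / 2).
  - intros z. unfold Rmin, Rabs. destruct (Rle_dec z c), (Rcase_abs (z - c)); lra.
  - assert (continuity_pt (fun z => Rabs (z - c)) K).
    { apply (continuity_pt_comp (fun z => z - c) Rabs); [reg | apply Rcontinuity_abs]. }
    unfold Rdiv. apply continuity_pt_mult; [|reg].
    apply continuity_pt_minus; auto. reg.
Qed.

Lemma continuity_sum_n (f : nat -> R -> R) (N : nat) :
  (forall n, continuity (f n)) -> continuity (fun x => sum_n (fun n => f n x) N).
Proof.
  intros Hf x. induction N as [|N IH].
  - apply continuity_pt_ext with (f 0%nat); [|apply Hf].
    intros y. symmetry. apply (sum_O (fun n => f n y)).
  - apply continuity_pt_ext with (fun x => sum_n (fun n => f n x) N + f (S N) x).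
    + intros y. symmetry. apply (sum_Sn (fun n => f n y)).
    + apply continuity_pt_plus; [apply IH | apply Hf].
Qed.

Lemma weight_small (l : nat -> R) (d : R) :
  weight l -> 0 < d -> exists N, forall n, (N <= n)%nat -> l n < d.
Proof.
  intros Hl Hd. pose proof (ex_series_lim_0 l (weight_ex l Hl)) as H.
  apply is_lim_seq_spec in H. destruct (H (mkposreal d Hd)) as [N HN].
  exists N. intros n Hn. specialize (HN n Hn). simpl in HN.
  rewrite Rminus_0_r in HN. apply Rabs_def2 in HN. lra.
Qed.

Lemma weight_le1 (l : nat -> R) (n : nat) : weight l -> l n <= 1.
Proof.
  intros Hl. rewrite <- (weight_Series l Hl), <- (is_series_unique _ _ (is_series_delta n (l n))).
  apply Series_le; [|apply weight_ex, Hl]. intros m. pose proof (proj1 Hl m).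
  destruct (Nat.eqb_spec m n) as [-> |]; lra.
Qed.

(* Small values are kept and large ones are replaced by a common constant [K]; the quadratic
   ramp in between restores the total mass, [K] being found by the intermediate value theorem. *)
Lemma cutoff_weight (l : nat -> R) (tau : R) :
  weight l -> 0 < tau < 1 ->
  exists K, tau <= K /\ weight (fun n => cutoff K tau (l n)).
Proof.
  intros Hl Htau. pose proof Hl as [Hp _].
  destruct (weight_small l tau Hl (proj1 Htau)) as [N HN].
  set (c := Series (fun k => l (S N + k)%nat)).
  (* Beyond [N] the values lie below [tau] and do not change, so the excess of mass depends on [K]
     through a finite sum only, which is continuous. At [K = tau] no value grows; at [K = / tau],
     which is above 1, none shrinks. *)
  set (g := fun K => sum_n (fun n => cutoff K tau (l n)) N + (c - 1)).
  assert (El : is_series (fun k => l (S N + k)%nat) c).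
  { apply Series_correct. apply -> (ex_series_incr_n l (S N)). apply weight_ex, Hl. }
  assert (T : 1 = sum_n l N + c).
  { rewrite <- (weight_Series l Hl), (Series_incr_n l (S N)) by (auto using weight_ex; lia).
    simpl pred. rewrite <- sum_n_Reals. reflexivity. }
  assert (Big : 1 < / tau) by (rewrite <- Rinv_1; apply Rinv_lt_contravar; lra).
  assert (Cg : continuity g).
  { apply continuity_plus; [|apply continuity_const; intros ? ?; auto].
    apply (continuity_sum_n (fun n K => cutoff K tau (l n))). intros n. apply continuity_cutoff. }
  assert (G1 : g tau <= 0).
  { assert (sum_n (fun n => cutoff tau tau (l n)) N <= sum_n l N); [|unfold g; lra].
    rewrite !sum_n_lsum. apply lsum_le. intros n _. apply cutoff_min_le; auto; lra. }
  assert (G2 : 0 <= g (/ tau)).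
  { assert (sum_n l N <= sum_n (fun n => cutoff (/ tau) tau (l n)) N); [|unfold g; lra].
    rewrite !sum_n_lsum. apply lsum_le. intros n _. apply cutoff_ge.
    pose proof (weight_le1 l n Hl). lra. }
  destruct (IVT_cor g tau (/ tau) Cg) as (K & [HK _] & EK); [lra | nra |].
  exists K. split; auto. split; [intros n; apply cutoff_pos; auto; lra|].
  replace 1 with (sum_n (fun n => cutoff K tau (l n)) N + c) by (unfold g in EK; lra).
  apply (is_series_ext (fun n => cutoff K tau (l n))); [reflexivity|].
  apply (is_series_decr_n _ (S N)); [lia|]. simpl pred.
  match goal with |- is_series _ ?v => replace v with c end.
  - apply (is_series_ext (fun k => l (S N + k)%nat)); auto.
    intros k. symmetry. apply cutoff_small; auto. apply Rlt_le, HN. lia.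
  - set (A := sum_n (fun n => cutoff K tau (l n)) N). change (c = A + c + - A). ring.
Qed.

Lemma flatten_weight (l : nat -> R) (d : R) : weight l -> 0 < d ->
  exists l', weight l' /\ (exists tau, 0 < tau /\ forall n, l n <= tau -> l' n = l n) /\
    forall (s : nat -> nat) (e : R), 0 <= e <= 1 ->
      (forall n, l n < d \/ l (s n) < d -> near e (l n) (l (s n))) ->
      forall n, near (3 * e) (l' n) (l' (s n)).
Proof.
  intros Hl Hd. set (tau := Rmin (1 / 2) (d * d / 2)).
  assert (Htau : 0 < tau < 1).
  { split; [apply Rmin_glb_lt; nra |]. apply Rle_lt_trans with (1 / 2); [apply Rmin_l | lra]. }
  assert (Htd : tau < d * d) by (apply Rle_lt_trans with (d * d / 2); [apply Rmin_r | nra]).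
  destruct (cutoff_weight l tau Hl Htau) as (K & HK & HW).
  exists (fun n => cutoff K tau (l n)). split; auto. pose proof Hl as [Hp _]. split.
  - exists tau. split; [apply Htau|]. intros n Hn. apply cutoff_small; auto.
  - intros s e He Hs n.
    (* No term of a weight exceeds 1, whereas the ramp does so on values at least [d]; all these are
       therefore cut off at the same [K]. *)
    assert (Big : forall m, d <= l m -> cutoff K tau (l m) = K).
    { intros m Hm. pose proof (weight_le1 _ m HW) as L. simpl in L. unfold cutoff in *.
      apply Rmin_left. destruct (Rle_dec K (Rmax (l m) (l m * l m / tau))) as [|Nle]; auto.
      exfalso. rewrite Rmin_right in L by lra.
      assert (1 < l m * l m / tau) by (apply Rlt_div_r; nra).
      pose proof (Rmax_r (l m) (l m * l m / tau)). lra. }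
    destruct (Rlt_dec (l n) d); [apply cutoff_near; auto; lra|].
    destruct (Rlt_dec (l (s n)) d); [apply cutoff_near; auto; lra|].
    rewrite !Big by lra. split; nra.
Qed.

(** * Almost invariance under a permutation *)

(** Smallness is measured by [l] and not by the index: flattening needs control of every pair with
    at least one value below a threshold, and of no other pair. *)
Definition almost_inv (l : nat -> R) (s : nat -> nat) : Prop :=
  forall e, 0 < e -> exists d, 0 < d /\
    forall n, l n < d \/ l (s n) < d -> near e (l n) (l (s n)).

Lemma almost_inv_comp (l : nat -> R) (s t : nat -> nat) :
  (forall n, 0 < l n) -> almost_inv l s -> almost_inv l t -> almost_inv l (fun n => s (t n)).
Proof.
  intros Hp Hs Ht e He. set (e' := Rmin 1 (e / 3)).
  assert (He' : 0 < e' <= 1) by (split; [apply Rmin_glb_lt; lra | apply Rmin_l]).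
  assert (He3 : e' <= e / 3) by apply Rmin_r.
  destruct (Hs e' (proj1 He')) as (d1 & P1 & H1). destruct (Ht e' (proj1 He')) as (d2 & P2 & H2).
  set (d := Rmin d1 d2). assert (0 < d) by (apply Rmin_glb_lt; auto).
  assert (d <= d1) by apply Rmin_l. assert (d <= d2) by apply Rmin_r.
  (* Since [e' <= 1], one step changes a small value by a factor of at most 2, so an outer value
     below [d / 2] keeps the intermediate one below [d]. *)
  exists (d / 2). split; [lra|]. intros n Hn.
  pose proof (Hp n). pose proof (Hp (t n)). pose proof (Hp (s (t n))).
  assert (K : near e' (l n) (l (t n)) /\ near e' (l (t n)) (l (s (t n)))).
  { destruct Hn as [Hn | Hn].
    - pose proof (H2 n ltac:(lra)) as A. split; auto. apply H1. left. destruct A. nra.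
    - pose proof (H1 (t n) ltac:(lra)) as A. split; auto. apply H2. right. destruct A. nra. }
  destruct K as [[A1 A2] [B1 B2]].
  assert (Q : (1 + e') * (1 + e') <= 1 + e) by nra.
  split.
  - apply Rle_trans with ((1 + e') * (1 + e') * l (s (t n))); [nra|].
    apply Rmult_le_compat_r; lra.
  - apply Rle_trans with ((1 + e') * (1 + e') * l n); [nra|].
    apply Rmult_le_compat_r; lra.
Qed.

(** * Shears of integer lists *)

(* The flag tells whether the current entry is shifted, by [s] times the previous entry;
   [p] stands for the entry before the first. The shifted entries are every other one, and they
   are shifted by unshifted ones, so the map is invertible and preserves the lexicographic order. *)
Fixpoint shear (s : Z) (par : bool) (p : Z) (v : list Z) : list Z :=
  match v with
  | nil => nil
  | x :: t => (x + if par then s * p else 0)%Z :: shear s (negb par) x t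
  end.

Fixpoint lexlt (u v : list Z) : bool :=
  match u, v with
  | _, nil => false
  | nil, _ :: _ => true
  | x :: t, y :: t' => (x <? y)%Z || (x =? y)%Z && lexlt t t'
  end.

Lemma shear_length (s : Z) (par : bool) (p : Z) (v : list Z) :
  length (shear s par p v) = length v.
Proof. revert par p. induction v as [|x v IH]; intros; simpl; auto. Qed.

Lemma shear_false (s p q : Z) (v : list Z) : shear s false p v = shear s false q v.
Proof. destruct v; reflexivity. Qed.

Lemma shear_inv (s p : Z) (par : bool) (v : list Z) :
  shear (- s) par p (shear s par p v) = v.
Proof.
  revert par p. induction v as [|x v IH]; intros par p; simpl; auto. f_equal.
  - destruct par; lia.
  - destruct par; simpl.
    + rewrite (shear_false _ _ x). apply IH.
    + rewrite Z.add_0_r. apply IH.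
Qed.

Lemma shear_lexlt (s p : Z) (par : bool) (u v : list Z) :
  lexlt (shear s par p u) (shear s par p v) = lexlt u v.
Proof.
  revert par p v. induction u as [|x u IH]; intros par p [|y v]; simpl; auto.
  set (c := if par then (s * p)%Z else 0%Z).
  destruct (Z.ltb_spec (x + c) (y + c)), (Z.ltb_spec x y); try lia; auto.
  destruct (Z.eqb_spec (x + c) (y + c)), (Z.eqb_spec x y); try lia; auto.
  subst y. simpl. apply IH.
Qed.

Lemma lexlt_irrefl (u : list Z) : lexlt u u = false.
Proof.
  induction u as [|x u IH]; simpl; auto. rewrite Z.ltb_irrefl, IH, andb_false_r. reflexivity.
Qed.

Lemma lexlt_trans (u v w : list Z) : lexlt u v = true -> lexlt v w = true -> lexlt u w = true.
Proof.
  revert v w. induction u as [|x u IH]; intros [|y v] [|z w]; simpl; try discriminate; auto.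
  rewrite !orb_true_iff, !andb_true_iff, !Z.ltb_lt, !Z.eqb_eq.
  intros [H1 | [H1 K1]] [H2 | [H2 K2]]; try (left; lia).
  right. split; [lia | eapply IH; eauto].
Qed.

Lemma lexlt_total (u v : list Z) : u = v \/ lexlt u v = true \/ lexlt v u = true.
Proof.
  revert v. induction u as [|x u IH]; intros [|y v]; simpl; auto.
  rewrite !orb_true_iff, !andb_true_iff, !Z.ltb_lt, !Z.eqb_eq.
  destruct (Z.lt_trichotomy x y) as [| [-> |]]; auto.
  destruct (IH v) as [-> | []]; auto.
Qed.

(** * Reduced words move some list *)

Definition sgn_letter (l : letter) : Z := if snd l then (-1)%Z else 1%Z.

Definition shear_letter (l : letter) (v : list Z) : list Z :=
  shear (sgn_letter l) (negb (fst l)) 1 v.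

Fixpoint shear_word (w : list letter) (v : list Z) : list Z :=
  match w with
  | nil => v
  | l :: w => shear_letter l (shear_word w v)
  end.

Lemma shear_word_length (w : list letter) (v : list Z) : length (shear_word w v) = length v.
Proof. induction w; simpl; auto. unfold shear_letter. rewrite shear_length. auto. Qed.

Lemma nth_shear (s : Z) (par : bool) (p : Z) (v : list Z) (j : nat) :
  (j < length v)%nat ->
  nth j (shear s par p v) 0%Z
  = (nth j v 0 + if xorb par (Nat.odd j) then s * nth j (p :: v) 0 else 0)%Z.
Proof.
  revert par p j. induction v as [|x v IH]; intros par p j Hj; simpl in Hj; [lia|].
  destruct j as [|j].
  - simpl. rewrite xorb_false_r. reflexivity.
  - cbn [shear nth]. rewrite IH by lia. rewrite Nat.odd_succ, <- Nat.negb_odd.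
    cbn [nth]. destruct par, (Nat.odd j); reflexivity.
Qed.

(* Coordinates are counted after prepending the constant 1 that the first entry may be shifted by. *)
Definition entry (v : list Z) (k : nat) : Z := nth k (1%Z :: v) 0%Z.

Lemma entry_shear (l : letter) (v : list Z) (k : nat) : (S k <= length v)%nat ->
  entry (shear_letter l v) (S k)
  = (entry v (S k) + if xorb (fst l) (Nat.odd (S k)) then sgn_letter l * entry v k else 0)%Z.
Proof.
  intros Hk. unfold entry, shear_letter. cbn [nth]. rewrite nth_shear by lia.
  rewrite Nat.odd_succ, <- Nat.negb_odd. destruct (fst l), (Nat.odd k); reflexivity.
Qed.

Lemma entry_beyond (v : list Z) (k : nat) : (length v < k)%nat -> entry v k = 0%Z.
Proof. intros H. apply nth_overflow. simpl. lia. Qed.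

Lemma entry_fixed (l : letter) (v : list Z) (k : nat) :
  xorb (fst l) (Nat.odd k) = false -> entry (shear_letter l v) k = entry v k.
Proof.
  intros H. destruct k as [|k]; [reflexivity|].
  destruct (le_lt_dec (S k) (length v)).
  - rewrite entry_shear, H by auto. lia.
  - rewrite !entry_beyond; unfold shear_letter; rewrite ?shear_length; auto.
Qed.

(* The last nonzero coordinate [S k] sits where the letter [l] acts, and has the sign of the last shift. *)
Definition top_entry (l : letter) (v : list Z) (k : nat) : Prop :=
  xorb (fst l) (Nat.odd (S k)) = true /\
  (0 < sgn_letter l * entry v (S k) * entry v k)%Z /\
  forall j, (S k < j)%nat -> entry v j = 0%Z.

Lemma xorb_odd_succ (b : bool) (k : nat) : xorb b (Nat.odd (S k)) = negb (xorb b (Nat.odd k)).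
Proof. rewrite Nat.odd_succ, <- Nat.negb_odd. destruct b, (Nat.odd k); reflexivity. Qed.

Lemma sgn_letter_sqr (l : letter) : (sgn_letter l * sgn_letter l = 1)%Z.
Proof. unfold sgn_letter. destruct (snd l); reflexivity. Qed.

(** The new shift has the sign that the top coordinate already has, so nothing cancels. The next
    coordinate has the wrong parity, and later ones are shifted by 0 at most. *)
Lemma top_entry_same (l : letter) (v : list Z) (k : nat) :
  (S k <= length v)%nat -> top_entry l v k -> top_entry l (shear_letter l v) k.
Proof.
  intros Hk (X & P & T). split; [|split]; auto.
  - assert (X' : xorb (fst l) (Nat.odd k) = false).
    { rewrite xorb_odd_succ in X. destruct (xorb _ _); auto. }
    rewrite (entry_fixed l v k X'), entry_shear, X by auto.
    replace (_ * _ * _)%Z with (sgn_letter l * entry v (S k) * entry v k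
      + (sgn_letter l * sgn_letter l) * (entry v k * entry v k))%Z by ring.
    rewrite sgn_letter_sqr. nia.
  - intros j Hj. destruct (le_lt_dec j (length v)) as [L | L].
    + destruct j as [|j]; [lia|]. rewrite entry_shear, (T (S j)) by auto.
      destruct (Nat.eq_dec j (S k)) as [-> | D].
      * rewrite xorb_odd_succ, X. reflexivity.
      * rewrite (T j), Z.mul_0_r by lia. destruct (xorb (fst l) (Nat.odd (S j))); reflexivity.
    + apply entry_beyond. unfold shear_letter. rewrite shear_length. auto.
Qed.

(** The last nonzero coordinate [k] has the parity that the letter leaves alone, and it is added, up
    to sign, to the coordinate [S k], which was 0. *)
Lemma top_entry_next (l : letter) (v : list Z) (k : nat) :
  (S k <= length v)%nat -> xorb (fst l) (Nat.odd (S k)) = true -> entry v k <> 0%Z ->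
  (forall j, (k < j)%nat -> entry v j = 0%Z) -> top_entry l (shear_letter l v) k.
Proof.
  intros Hk X P T.
  assert (X' : xorb (fst l) (Nat.odd k) = false).
  { rewrite xorb_odd_succ in X. destruct (xorb _ _); auto. }
  split; [|split]; auto.
  - rewrite (entry_fixed l v k X'), entry_shear, X, (T (S k)) by auto.
    pose proof (sgn_letter_sqr l). nia.
  - intros j Hj. destruct (le_lt_dec j (length v)) as [L | L].
    + destruct j as [|j]; [lia|]. rewrite entry_shear, (T (S j)), (T j), Z.mul_0_r by lia.
      destruct (xorb (fst l) (Nat.odd (S j))); reflexivity.
    + apply entry_beyond. unfold shear_letter. rewrite shear_length. auto.
Qed.

(** The generator [false] shifts the first entry by the constant 1 and can start from zeros. The
    generator [true] leaves the first entry alone and needs it nonzero to move the second. *)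
Definition start (g : bool) (n : nat) : list Z := (if g then 1%Z else 0%Z) :: repeat 0%Z n.

Lemma start_beyond (g : bool) (n k : nat) : (Nat.b2n g < k)%nat -> entry (start g n) k = 0%Z.
Proof.
  intros H. unfold entry, start. destruct k as [|[|k]]; [lia | |].
  - destruct g; [simpl in H; lia | reflexivity].
  - cbn [nth]. apply nth_repeat.
Qed.

(** Induction from the innermost letter, which determines [g]: a change of generator pushes the last
    nonzero coordinate one place further, a repeated one keeps it. The length leaves room for every
    push. *)
Lemma shear_word_top (w : list letter) (l : letter) (n : nat) :
  reduced (l :: w) -> (length w + 2 <= n)%nat ->
  exists g k, (Nat.b2n g <= k <= length w + Nat.b2n g)%nat /\
    top_entry l (shear_word (l :: w) (start g n)) k.
Proof.
  revert l. induction w as [|l2 w IH]; intros l Hr Hn.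
  - exists (fst l), (Nat.b2n (fst l)). split; [simpl; lia|].
    apply top_entry_next.
    + simpl. rewrite repeat_length. destruct (fst l); simpl in *; lia.
    + destruct (fst l); reflexivity.
    + destruct (fst l); discriminate.
    + intros j Hj. apply start_beyond. auto.
  - destruct Hr as [Hc Hr]. simpl in Hn. destruct (IH l2 Hr ltac:(lia)) as (g & k & Hk & Ht).
    assert (Hg : (Nat.b2n g <= 1)%nat) by (destruct g; simpl; lia).
    assert (L : length (shear_word (l2 :: w) (start g n)) = S n).
    { rewrite shear_word_length. simpl. rewrite repeat_length. reflexivity. }
    exists g. destruct (bool_dec (fst l) (fst l2)) as [E | E].
    (* In a reduced word, neighbouring letters with the same generator have the same sign. *)
    + assert (El : l = l2).
      { unfold cancels in Hc. destruct l as [a b], l2 as [a2 b2]. simpl in *. subst a2. f_equal.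
        destruct (bool_dec b b2); auto. destruct Hc; auto. }
      subst l2. exists k. split; [simpl; lia|].
      apply (top_entry_same l (shear_word (l :: w) (start g n))); [lia | exact Ht].
    + destruct Ht as (X & P & T). exists (S k). split; [simpl; lia|].
      apply (top_entry_next l (shear_word (l2 :: w) (start g n))); auto; [lia | | nia].
      rewrite xorb_odd_succ. destruct (fst l), (fst l2), (Nat.odd (S k)); simpl in *; congruence.
Qed.

Lemma shear_word_moves (w : list letter) :
  reduced w -> w <> nil -> exists v, shear_word w v <> v.
Proof.
  intros Hr Hw. destruct w as [|l w]; [congruence|].
  destruct (shear_word_top w l (length w + 2) Hr (le_n _)) as (g & k & Hk & (_ & P & _)).
  exists (start g (length w + 2)). intros E. rewrite E in P.
  rewrite (start_beyond g _ (S k)) in P by lia. lia.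
Qed.

(** * Growth of the height under a shear *)

Lemma pow_near_1 (m : nat) (e : R) : 0 < e -> exists d, 0 < d <= 1 /\ (1 + d) ^ m <= 1 + e.
Proof.
  revert e. induction m as [|m IH]; intros e He.
  - exists 1. simpl. lra.
  - set (e' := Rmin 1 (e / 3)).
    assert (He' : 0 < e' <= 1) by (split; [apply Rmin_glb_lt; lra | apply Rmin_l]).
    assert (He3 : e' <= e / 3) by apply Rmin_r.
    destruct (IH e' (proj1 He')) as (d & Hd & K). exists (Rmin d e').
    assert (0 < Rmin d e' <= 1).
    { split; [apply Rmin_glb_lt; lra |]. apply Rle_trans with d; [apply Rmin_l | lra]. }
    split; auto. simpl. apply Rle_trans with ((1 + e') * (1 + e')); [|nra].
    apply Rmult_le_compat; [lra | apply pow_le; lra | |].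
    + pose proof (Rmin_r d e'). lra.
    + eapply Rle_trans; [|apply K]. apply pow_incr. pose proof (Rmin_l d e'). lra.
Qed.

(** If [b <= d * a], the factor [(1 + d) ^ m] is enough. Otherwise the left side is at most
    [C * b ^ m], which [e * b ^ S m] absorbs for [b >= C / e] and the constant [M] absorbs for
    smaller [b]. *)
Lemma pow_add_le (m : nat) (e : R) : 0 < e -> exists M, 0 <= M /\
  forall a b, 0 <= a -> 0 <= b -> (a + b) ^ m <= a ^ m + e * (M + a ^ m + b ^ S m).
Proof.
  intros He. destruct (pow_near_1 m e He) as (d & Hd & K).
  set (C := (/ d + 1) ^ m).
  assert (HC : 0 < C) by (apply pow_lt; pose proof (Rinv_0_lt_compat d (proj1 Hd)); lra).
  assert (HCe : 0 < C / e) by (apply Rdiv_lt_0_compat; auto).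
  set (M := C * (C / e) ^ m / e).
  assert (HM : 0 < M).
  { apply Rdiv_lt_0_compat; auto. apply Rmult_lt_0_compat; auto. apply pow_lt; auto. }
  exists M. split; [lra|]. intros a b Ha Hb.
  assert (Pa : 0 <= a ^ m) by (apply pow_le; auto).
  assert (Pb : 0 <= b ^ m) by (apply pow_le; auto).
  assert (Pb' : 0 <= e * b ^ S m) by (apply Rmult_le_pos; [lra | apply pow_le; auto]).
  assert (PM : 0 <= e * M) by (apply Rmult_le_pos; lra).
  assert (Pae : 0 <= e * a ^ m) by (apply Rmult_le_pos; lra).
  destruct (Rle_dec b (d * a)) as [L | L].
  - assert ((a + b) ^ m <= (1 + d) ^ m * a ^ m).
    { rewrite <- Rpow_mult_distr. apply pow_incr. lra. }
    assert ((1 + d) ^ m * a ^ m <= (1 + e) * a ^ m) by (apply Rmult_le_compat_r; auto).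
    lra.
  - assert (Q : (a + b) ^ m <= C * b ^ m).
    { unfold C. rewrite <- Rpow_mult_distr. apply pow_incr. split; [lra|].
      assert (a <= / d * b).
      { apply Rmult_le_reg_l with d; [lra|]. rewrite <- Rmult_assoc, Rinv_r by lra. lra. }
      lra. }
    destruct (Rle_dec (C / e) b) as [L' | L'].
    + assert (C <= e * b) by (apply (Rmult_le_compat_l e) in L'; [|lra]; field_simplify in L'; lra).
      assert (C * b ^ m <= e * b * b ^ m) by (apply Rmult_le_compat_r; auto).
      simpl in *. lra.
    + assert (b ^ m <= (C / e) ^ m) by (apply pow_incr; lra).
      assert (C * b ^ m <= C * (C / e) ^ m) by (apply Rmult_le_compat_l; lra).
      replace (C * (C / e) ^ m) with (e * M) in * by (unfold M; field; lra). lra.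
Qed.

(* The [i]-th of [k] entries counts with exponent [k - i]: shifting an entry by its predecessor,
   which has a larger exponent, then changes the height by a lower-order amount. *)
Fixpoint height (v : list Z) : R :=
  match v with
  | nil => 0
  | x :: t => Rabs (IZR x) ^ S (length t) + height t
  end.

Lemma height_nonneg (v : list Z) : 0 <= height v.
Proof.
  induction v; simpl; [lra|]. apply Rplus_le_le_0_compat; auto.
  apply Rmult_le_pos; [|apply pow_le]; apply Rabs_pos.
Qed.

Lemma height_entry (v : list Z) (x : Z) : In x v -> Rabs (IZR x) <= height v.
Proof.
  induction v as [|y v IH]; intros H; [destruct H|].
  cbn [height]. pose proof (height_nonneg v).
  pose proof (Rabs_pos (IZR y)) as P. pose proof (pow_le _ (S (length v)) P).
  destruct H as [<- | H]; [|specialize (IH H); lra].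
  apply Rle_trans with (Rabs (IZR y) ^ S (length v)); [|lra].
  destruct (Z.eq_dec y 0) as [-> | D].
  - rewrite Rabs_R0. apply pow_le. lra.
  - assert (1 <= Rabs (IZR y)).
    { rewrite <- abs_IZR. apply IZR_le. lia. }
    pose proof (pow_R1_Rle (Rabs (IZR y)) (length v) ltac:(auto)). simpl. nra.
Qed.

(** The preceding entry [p] is arbitrary because the tail is shifted by the head. The cost of that
    shift is charged to the head's own term in the height, which has just the exponent required;
    this term is charged twice, hence the halves of [e]. *)
Lemma height_shear_gen (k : nat) (e : R) : 0 < e -> exists M, 0 <= M /\
  forall (v : list Z) (s p : Z) (par : bool), length v = k -> (s = 1 \/ s = -1)%Z ->
    height (shear s par p v) <= height v + e * (M + height v + Rabs (IZR p) ^ S k).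
Proof.
  revert e. induction k as [|k IH]; intros e He.
  - exists 0. split; [lra|]. intros [|x v] s p par Hv _; [|discriminate]. simpl.
    pose proof (Rmult_le_pos e (Rabs (IZR p)) ltac:(lra) (Rabs_pos _)). lra.
  - destruct (IH (e / 2) ltac:(lra)) as (M1 & HM1 & K1).
    destruct (pow_add_le (S k) (e / 2) ltac:(lra)) as (M2 & HM2 & K2).
    exists (M1 + M2). split; [lra|].
    intros [|x t] s p par Hv Hs; [discriminate|]. injection Hv as Hv.
    specialize (K1 t s x (negb par) Hv Hs).
    specialize (K2 (Rabs (IZR x)) (Rabs (IZR p)) (Rabs_pos _) (Rabs_pos _)).
    cbn [shear height]. rewrite shear_length, Hv.
    assert (A : Rabs (IZR (x + (if par then s * p else 0))) <= Rabs (IZR x) + Rabs (IZR p)).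
    { rewrite plus_IZR. eapply Rle_trans; [apply Rabs_triang|]. apply Rplus_le_compat_l.
      pose proof (Rabs_pos (IZR p)). destruct par; [|rewrite Rabs_R0; auto].
      destruct Hs as [-> | ->].
      - rewrite Z.mul_1_l. lra.
      - replace (-1 * p)%Z with (- p)%Z by ring. rewrite opp_IZR, Rabs_Ropp. lra. }
    apply (fun H => pow_incr _ _ (S k) (conj (Rabs_pos _) H)) in A.
    pose proof (height_nonneg t) as Ht.
    pose proof (pow_le _ (S (S k)) (Rabs_pos (IZR p))).
    set (X := Rabs (IZR x) ^ S k) in *. set (P := Rabs (IZR p) ^ S (S k)) in *.
    assert (0 <= e / 2 * (M1 + M2 + height t + P)) by (apply Rmult_le_pos; lra). nra.
Qed.

Lemma height_shear_letter (k : nat) (e : R) : 0 < e -> exists M, 1 <= M /\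
  forall (v : list Z) (l : letter), length v = k ->
    height (shear_letter l v) <= height v + e * (M + height v).
Proof.
  intros He. destruct (height_shear_gen k e He) as (M & HM & K). exists (M + 1). split; [lra|].
  intros v l Hv. specialize (K v (sgn_letter l) 1%Z (negb (fst l)) Hv).
  rewrite Rabs_R1, pow1 in K. unfold shear_letter.
  replace (M + 1 + height v) with (M + height v + 1) by ring. apply K.
  unfold sgn_letter. destruct (snd l); auto.
Qed.

(** * Nearly invariant weights on lists of one length *)

Definition inv_letter (l : letter) : letter := (fst l, negb (snd l)).

Lemma shear_inv_letter (l : letter) (v : list Z) : shear_letter (inv_letter l) (shear_letter l v) = v.
Proof.
  unfold shear_letter. replace (sgn_letter (inv_letter l)) with (- sgn_letter l)%Z.
  - apply shear_inv.
  - destruct l as [g []]; reflexivity.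
Qed.

Lemma inv_letter_inv (l : letter) : inv_letter (inv_letter l) = l.
Proof. destruct l as [g []]; reflexivity. Qed.

Lemma shear_letter_length (l : letter) (v : list Z) : length (shear_letter l v) = length v.
Proof. apply shear_length. Qed.

(** The exponent is the number of entries and 8 is the constant of [zrecip], so that a product of
    [zrecip] over the entries dominates. This domination holds for every [M >= 1], which leaves [M]
    free. *)
Definition decay (M : R) (v : list Z) : R := (/ (8 * (M + height v) ^ 2)) ^ length v.

Lemma decay_pos (M : R) (v : list Z) : 1 <= M -> 0 < decay M v.
Proof.
  intros HM. apply pow_lt, Rinv_0_lt_compat. pose proof (height_nonneg v). nra.
Qed.

Lemma decay_compare (M d : R) (u v : list Z) :
  1 <= M -> 0 <= d -> length u = length v -> M + height v <= (1 + d) * (M + height u) ->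
  decay M u <= (1 + d) ^ (2 * length u) * decay M v.
Proof.
  intros HM Hd L H. unfold decay. rewrite <- L, pow_mult, <- Rpow_mult_distr.
  pose proof (height_nonneg u). pose proof (height_nonneg v).
  set (V := M + height v) in *. set (U := M + height u) in *.
  assert (0 < U) by (unfold U; lra). assert (0 < V) by (unfold V; lra).
  apply pow_incr. split; [apply Rlt_le, Rinv_0_lt_compat; nra|].
  apply Rmult_le_reg_r with (8 * U ^ 2); [nra|]. rewrite Rinv_l by nra.
  replace ((1 + d) ^ 2 * / (8 * V ^ 2) * (8 * U ^ 2)) with (((1 + d) * U) ^ 2 / V ^ 2)
    by (field; lra).
  apply Rle_div_r; [nra|]. rewrite Rmult_1_l. apply pow_incr. lra.
Qed.

Lemma decay_near (k : nat) (e : R) : 0 < e -> exists d, 0 < d <= 1 /\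
  forall (M : R) (u v : list Z), 1 <= M -> length u = k -> length v = k ->
    M + height v <= (1 + d) * (M + height u) -> M + height u <= (1 + d) * (M + height v) ->
    near e (decay M u) (decay M v).
Proof.
  intros He. destruct (pow_near_1 (2 * k) e He) as (d & Hd & K). exists d. split; auto.
  intros M u v HM Hu Hv H1 H2.
  pose proof (decay_pos M u HM). pose proof (decay_pos M v HM). split.
  - eapply Rle_trans; [apply (decay_compare M d u v); auto; [lra | congruence]|].
    rewrite Hu. apply Rmult_le_compat_r; lra.
  - eapply Rle_trans; [apply (decay_compare M d v u); auto; [lra | congruence]|].
    rewrite Hv. apply Rmult_le_compat_r; lra.
Qed.

(** A letter changes the height by at most [d * (M + height)]. With the same [M] added to the
    height, this is a relative change of at most [d] for all lists of the given length. *)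
Lemma decay_near_uniform (k : nat) (e : R) : 0 < e -> exists M, 1 <= M /\
  forall (v : list Z) (l : letter), length v = k ->
    near e (decay M v) (decay M (shear_letter l v)).
Proof.
  intros He. destruct (decay_near k e He) as (d & Hd & D).
  destruct (height_shear_letter k d (proj1 Hd)) as (M & HM & K).
  exists M. split; auto. intros v l Hv.
  assert (Hs : length (shear_letter l v) = k) by (rewrite shear_letter_length; auto).
  apply D; auto.
  - specialize (K v l Hv). lra.
  - specialize (K _ (inv_letter l) Hs). rewrite shear_inv_letter in K. lra.
Qed.

Lemma height_near (k : nat) (d : R) : 0 < d <= 1 -> exists B,
  0 <= B /\ forall (v : list Z) (l : letter), length v = k ->
    B <= height v \/ B <= height (shear_letter l v) ->
    height (shear_letter l v) <= (1 + d) * height v /\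
    height v <= (1 + d) * height (shear_letter l v).
Proof.
  intros Hd. destruct (height_shear_letter k (d / 2) ltac:(lra)) as (M & HM & K).
  (* As [d / 2 <= 1 / 2], one height of at least [3 * M] forces both to be at least [M]; the
     constant [M] in the error is then absorbed by the height. *)
  exists (3 * M). split; [lra|]. intros v l Hv HB.
  assert (Hs : length (shear_letter l v) = k) by (rewrite shear_letter_length; auto).
  pose proof (K v l Hv) as K1. pose proof (K _ (inv_letter l) Hs) as K2.
  rewrite shear_inv_letter in K2.
  pose proof (height_nonneg v). pose proof (height_nonneg (shear_letter l v)).
  assert (Q : M <= height v /\ M <= height (shear_letter l v)).
  { destruct HB; split; try lra; nra. }
  split; nra.
Qed.

Lemma near_weaken (e e' a b : R) : 0 <= a -> 0 <= b -> e <= e' -> near e a b -> near e' a b.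
Proof. intros Ha Hb He [H1 H2]. split; nra. Qed.

(** Here [M] is prescribed. For a fixed length, a small value of [decay] forces a large height,
    where a letter acts with small relative error. *)
Lemma decay_near_small (k : nat) (M e : R) : 1 <= M -> 0 < e -> exists c, 0 < c /\
  forall (v : list Z) (l : letter), length v = k ->
    decay M v < c \/ decay M (shear_letter l v) < c ->
    near e (decay M v) (decay M (shear_letter l v)).
Proof.
  intros HM He. destruct (decay_near k e He) as (d & Hd & D).
  destruct (height_near k d Hd) as (B & HB & K).
  assert (P : 0 < / (8 * (M + B) ^ 2)) by (apply Rinv_0_lt_compat; nra).
  exists ((/ (8 * (M + B) ^ 2)) ^ k). split; [apply pow_lt; auto|].
  assert (C : forall u, length u = k -> decay M u < (/ (8 * (M + B) ^ 2)) ^ k -> B <= height u).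
  { intros u Hu Hc. apply Rnot_lt_le. intros Hlt. apply (Rlt_not_le _ _ Hc).
    unfold decay. rewrite Hu. apply pow_incr. split; [lra|].
    pose proof (height_nonneg u). apply Rinv_le_contravar; [nra|].
    apply Rmult_le_compat_l; [lra|]. apply pow_incr. lra. }
  intros v l Hv Hc.
  assert (Hs : length (shear_letter l v) = k) by (rewrite shear_letter_length; auto).
  destruct (K v l Hv) as [K1 K2].
  { destruct Hc; [left | right]; apply C; auto. }
  apply D; auto; nra.
Qed.

(** * Summability over all lists *)

Definition zrecip (z : Z) : R := / (8 * (1 + Rabs (IZR z)) ^ 2).

Lemma zrecip_pos (z : Z) : 0 < zrecip z.
Proof. apply Rinv_0_lt_compat. pose proof (Rabs_pos (IZR z)). nra. Qed.

Lemma lsum_recip_sqr (N : nat) : lsum (fun n => / (8 * (1 + INR n) ^ 2)) (seq 0 (S N)) <= / 4.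
Proof.
  assert (H : lsum (fun n => / (8 * (1 + INR n) ^ 2)) (seq 0 (S N)) <= / 8 * (2 - / (1 + INR N))).
  { induction N as [|N IH].
    - simpl. lra.
    - rewrite (seq_S (S N) 0), lsum_app. eapply Rle_trans; [apply Rplus_le_compat_r, IH|].
      cbn [lsum Nat.add]. rewrite S_INR. pose proof (pos_INR N). set (t := INR N) in *.
      assert (/ (8 * (1 + (t + 1)) ^ 2) <= / 8 * (/ (1 + t) - / (1 + (t + 1)))); [|lra].
      replace (/ 8 * (/ (1 + t) - / (1 + (t + 1)))) with (/ (8 * ((1 + t) * (1 + (t + 1)))))
        by (field; lra).
      apply Rinv_le_contravar; nra. }
  pose proof (pos_INR N). assert (0 < / (1 + INR N)) by (apply Rinv_0_lt_compat; lra). lra.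
Qed.

Lemma lsum_zrecip (L : list Z) : NoDup L -> lsum zrecip L <= / 2.
Proof.
  intros HL. set (N := list_max (map Z.abs_nat L)).
  (* Zero is listed twice, which only enlarges the sum. *)
  set (J := map Z.of_nat (seq 0 (S N)) ++ map (fun n => (- Z.of_nat n)%Z) (seq 0 (S N))).
  apply Rle_trans with (lsum zrecip J).
  - apply lsum_incl; auto.
    + intros z. apply Rlt_le, zrecip_pos.
    + intros z Hz. apply in_or_app.
      assert (K : (list_max (map Z.abs_nat L) <= N)%nat) by (unfold N; lia).
      apply list_max_le in K. rewrite Forall_forall in K.
      specialize (K _ (in_map Z.abs_nat _ _ Hz)).
      assert (Hin : In (Z.abs_nat z) (seq 0 (S N))) by (apply in_seq; lia).
      destruct (Z_le_gt_dec 0 z); [left | right]; apply in_map_iff; exists (Z.abs_nat z);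
        split; auto; lia.
  - unfold J. rewrite lsum_app, !lsum_map. pose proof (lsum_recip_sqr N) as H.
    assert (E : forall g : nat -> Z, (forall n, Rabs (IZR (g n)) = INR n) ->
      lsum (fun n => zrecip (g n)) (seq 0 (S N)) <= / 4).
    { intros g Hg. eapply Rle_trans; [|apply H]. apply lsum_le. intros n _.
      unfold zrecip. rewrite Hg. lra. }
    assert (E1 := E Z.of_nat). assert (E2 := E (fun n => (- Z.of_nat n)%Z)).
    assert (Ab : forall n, Rabs (INR n) = INR n) by (intros; apply Rabs_right, Rle_ge, pos_INR).
    assert (lsum (fun n => zrecip (Z.of_nat n)) (seq 0 (S N)) <= / 4).
    { apply E1. intros n. rewrite <- INR_IZR_INZ. auto. }
    assert (lsum (fun n => zrecip (- Z.of_nat n)) (seq 0 (S N)) <= / 4).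
    { apply E2. intros n. rewrite opp_IZR, Rabs_Ropp, <- INR_IZR_INZ. auto. }
    lra.
Qed.

Fixpoint lprod (q : Z -> R) (v : list Z) : R :=
  match v with
  | nil => 1
  | x :: t => q x * lprod q t
  end.

Lemma lprod_pos (q : Z -> R) (v : list Z) : (forall z, 0 < q z) -> 0 < lprod q v.
Proof.
  intros H. induction v; simpl; [lra | apply Rmult_lt_0_compat; auto].
Qed.

Fixpoint box (K : nat) (B : list Z) : list (list Z) :=
  match K with
  | O => nil :: nil
  | S K => nil :: flat_map (fun x => map (cons x) (box K B)) B
  end.

Lemma in_box (K : nat) (B v : list Z) :
  (length v <= K)%nat -> incl v B -> In v (box K B).
Proof.
  revert v. induction K as [|K IH]; intros [|x v] Hl Hi; simpl in *; auto; [lia|].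
  right. apply in_flat_map. exists x. split; [apply Hi; left; auto|].
  apply in_map, IH; [lia|]. intros y Hy. apply Hi. right. auto.
Qed.

(** Splitting off the head turns a sum [S] into [1 + lsum q B * S], and the bound 2 is preserved
    because [lsum q B <= / 2]. *)
Lemma lsum_box (q : Z -> R) (K : nat) (B : list Z) :
  (forall z, 0 < q z) -> lsum q B <= / 2 -> lsum (lprod q) (box K B) <= 2.
Proof.
  intros Hq HB. induction K as [|K IH]; simpl; [lra|].
  assert (E : forall C, lsum (lprod q) (flat_map (fun x => map (cons x) (box K B)) C)
    = lsum q C * lsum (lprod q) (box K B)).
  { induction C as [|x C IHC]; simpl; [ring|].
    rewrite lsum_app, lsum_map, IHC. simpl. rewrite lsum_scal. ring. }
  rewrite E.
  assert (0 <= lsum q B) by (apply lsum_nonneg; intros; apply Rlt_le; auto).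
  assert (0 <= lsum (lprod q) (box K B))
    by (apply lsum_nonneg; intros; apply Rlt_le, lprod_pos; auto). nra.
Qed.

Lemma lsum_lprod (q : Z -> R) (L : list (list Z)) :
  (forall z, 0 < q z) -> (forall B, NoDup B -> lsum q B <= / 2) ->
  NoDup L -> lsum (lprod q) L <= 2.
Proof.
  intros Hq HB HL. set (K := list_max (map (@length Z) L)).
  set (B := nodup Z.eq_dec (concat L)).
  apply Rle_trans with (lsum (lprod q) (box K B)); [|apply lsum_box; auto; apply HB, NoDup_nodup].
  apply lsum_incl; auto; [intros; apply Rlt_le, lprod_pos; auto|].
  intros v Hv. apply in_box.
  - assert (P : (list_max (map (@length Z) L) <= K)%nat) by (unfold K; lia).
    apply list_max_le in P. rewrite Forall_forall in P. apply P, in_map, Hv.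
  - intros x Hx. apply nodup_In, in_concat. eauto.
Qed.

(** Every [1 + Rabs (IZR x)] is at most [M + height v], so each of the equal factors of [decay] is
    below the factor of its entry. *)
Lemma decay_le_lprod (M : R) (v : list Z) : 1 <= M -> decay M v <= lprod zrecip v.
Proof.
  intros HM.
  assert (G : forall A t, (forall x, In x t -> 1 + Rabs (IZR x) <= A) ->
    (/ (8 * A ^ 2)) ^ length t <= lprod zrecip t).
  { intros A t. induction t as [|x t IH]; intros HA; simpl length; [simpl; lra|].
    assert (H1 : 1 + Rabs (IZR x) <= A) by (apply HA; left; auto).
    pose proof (Rabs_pos (IZR x)). cbn [lprod pow].
    apply Rmult_le_compat.
    - apply Rlt_le, Rinv_0_lt_compat. nra.
    - apply pow_le, Rlt_le, Rinv_0_lt_compat. nra.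
    - apply Rinv_le_contravar; [nra|]. apply Rmult_le_compat_l; [lra|].
      apply (pow_incr _ _ 2). lra.
    - apply IH. intros y Hy. apply HA. right. auto. }
  apply G. intros x Hx. pose proof (height_entry v x Hx). lra.
Qed.

Lemma finite_min (P : nat -> R -> Prop) (R0 : nat) :
  (forall k, exists c, 0 < c /\ P k c) ->
  (forall k c c', 0 < c' <= c -> P k c -> P k c') ->
  exists c, 0 < c /\ forall k, (k < R0)%nat -> P k c.
Proof.
  intros HP Hm. induction R0 as [|n (c & Hc & IH)].
  - exists 1. split; [lra | intros; lia].
  - destruct (HP n) as (c' & Hc' & K). exists (Rmin c c').
    assert (0 < Rmin c c') by (apply Rmin_glb_lt; auto). split; auto.
    intros k Hk. destruct (Nat.eq_dec k n) as [-> | D].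
    + apply Hm with c'; auto. split; auto. apply Rmin_r.
    + apply Hm with c; [split; auto; apply Rmin_l | apply IH; lia].
Qed.

(* The constants of [decay] are chosen length by length, so that long lists are nearly invariant
   whatever their height. *)
Lemma list_weight : exists f : list Z -> R,
  (forall v, 0 < f v) /\ (forall L, NoDup L -> lsum f L <= 2) /\
  forall e, 0 < e -> exists c, 0 < c /\ forall (v : list Z) (l : letter),
    f v < c \/ f (shear_letter l v) < c -> near e (f v) (f (shear_letter l v)).
Proof.
  destruct (functional_choice (fun k M => 1 <= M /\
    forall (v : list Z) (l : letter), length v = k ->
      near (/ INR (S k)) (decay M v) (decay M (shear_letter l v)))) as [M HM].
  { intros k. apply decay_near_uniform, Rinv_0_lt_compat, lt_0_INR. lia. }
  set (f := fun v => decay (M (length v)) v).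
  assert (Hf : forall v, 0 < f v) by (intros v; apply decay_pos, HM).
  exists f. split; [auto | split].
  - intros L HL. eapply Rle_trans; [|apply (lsum_lprod zrecip L); auto using zrecip_pos, lsum_zrecip].
    apply lsum_le. intros v _. apply decay_le_lprod, HM.
  - intros e He.
    (* Lists of length at least [1 / e] are within [e] without any smallness condition, by the
       choice of [M]. Only finitely many lengths remain, and the least of their thresholds is
       taken. *)
    destruct (finite_min (fun k c => forall (v : list Z) (l : letter), length v = k ->
      f v < c \/ f (shear_letter l v) < c -> near e (f v) (f (shear_letter l v)))
      (Z.to_nat (up (/ e)))) as (c & Hc & K).
    + intros k. destruct (decay_near_small k (M k) e (proj1 (HM k)) He) as (c & Hc & K).
      exists c. split; auto. intros v l Hv. unfold f. rewrite shear_letter_length, Hv. auto.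
    + intros k c c' Hc K v l Hv Hs. apply K; auto. destruct Hs; [left | right]; lra.
    + exists c. split; auto. intros v l Hs.
      destruct (le_lt_dec (Z.to_nat (up (/ e))) (length v)) as [Hl | Hl]; [|eapply K; eauto].
      apply near_weaken with (/ INR (S (length v))); auto using Rlt_le.
      * rewrite <- (Rinv_inv e). apply Rinv_le_contravar; [apply Rinv_0_lt_compat; auto|].
        destruct (archimed (/ e)) as [A _]. apply Rle_trans with (IZR (up (/ e))); [lra|].
        rewrite INR_IZR_INZ. apply IZR_le. lia.
      * unfold f. rewrite shear_letter_length. apply HM. reflexivity.
Qed.

(** * Coding lists by natural numbers *)

Definition code_Z (z : Z) : nat :=
  if (0 <=? z)%Z then (2 * Z.to_nat z)%nat else (2 * Z.to_nat (- z) - 1)%nat.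

Definition decode_Z (n : nat) : Z :=
  if Nat.even n then Z.of_nat (Nat.div2 n) else (- Z.of_nat (Nat.div2 (S n)))%Z.

Lemma decode_code_Z (z : Z) : decode_Z (code_Z z) = z.
Proof.
  unfold code_Z, decode_Z. destruct (Z.leb_spec 0 z).
  - rewrite Nat.even_even, Nat.div2_double. lia.
  - destruct (Z.to_nat (- z)) as [|m] eqn:E; [lia|].
    replace (2 * S m - 1)%nat with (S (2 * m)) by lia.
    rewrite Nat.even_succ, <- Nat.negb_even, Nat.even_even. cbv iota beta delta [negb].
    replace (S (S (2 * m))) with (2 * S m)%nat by lia. rewrite Nat.div2_double. lia.
Qed.

Lemma code_decode_Z (n : nat) : code_Z (decode_Z n) = n.
Proof.
  unfold code_Z, decode_Z. destruct (Nat.even n) eqn:E.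
  - apply Nat.even_spec in E. destruct E as [m ->]. rewrite Nat.div2_double.
    destruct (Z.leb_spec 0 (Z.of_nat m)); lia.
  - assert (O : Nat.Odd n) by (apply Nat.odd_spec; rewrite <- Nat.negb_even, E; reflexivity).
    destruct O as [m ->]. replace (S (2 * m + 1)) with (2 * S m)%nat by lia.
    rewrite Nat.div2_double. destruct (Z.leb_spec 0 (- Z.of_nat (S m))); lia.
Qed.

Fixpoint code (v : list Z) : nat :=
  match v with
  | nil => 0%nat
  | x :: t => S (Cantor.to_nat (code_Z x, code t))
  end.

(** The recursive argument is a Cantor component and not a structural subterm; as it decreases
    strictly, [n] itself is enough fuel. *)
Fixpoint decode_fuel (fuel n : nat) : list Z :=
  match fuel, n with
  | S fuel, S n => let (a, b) := Cantor.of_nat n in decode_Z a :: decode_fuel fuel b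
  | _, _ => nil
  end.

Definition decode (n : nat) : list Z := decode_fuel n n.

Lemma code_decode (n : nat) : code (decode n) = n.
Proof.
  unfold decode. assert (H : forall f n, (n <= f)%nat -> code (decode_fuel f n) = n); [|auto].
  clear n. induction f as [|f IH]; intros [|n] Hn; try reflexivity; [lia|].
  simpl. destruct (Cantor.of_nat n) as [a b] eqn:E. cbn [code].
  assert (E' : Cantor.to_nat (a, b) = n) by (rewrite <- E; apply Cantor.cancel_to_of).
  pose proof (Cantor.to_nat_non_decreasing a b).
  rewrite code_decode_Z, IH, E' by lia. reflexivity.
Qed.

Lemma decode_code (v : list Z) : decode (code v) = v.
Proof.
  unfold decode.
  assert (H : forall f v, (code v <= f)%nat -> decode_fuel f (code v) = v); [|auto].
  clear v. induction f as [|f IH]; intros [|x v] Hv; try reflexivity; [simpl in Hv; lia|].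
  cbn [code decode_fuel] in *. rewrite Cantor.cancel_of_to, decode_code_Z.
  pose proof (Cantor.to_nat_non_decreasing (code_Z x) (code v)).
  rewrite IH by lia. reflexivity.
Qed.

(** * The action and its weight on natural numbers *)

Definition lexlt_nat (m n : nat) : bool := lexlt (decode m) (decode n).

Lemma strict_order_lexlt_nat : strict_order lexlt_nat.
Proof.
  unfold lexlt_nat. split; [|split].
  - intros n. apply lexlt_irrefl.
  - intros m n k. apply lexlt_trans.
  - intros m n. destruct (lexlt_total (decode m) (decode n)) as [E | E]; auto.
    left. rewrite <- (code_decode m), E, code_decode. reflexivity.
Qed.

Definition letter_perm (l : letter) (n : nat) : nat := code (shear_letter l (decode n)).

Fixpoint word_perm (w : list letter) (n : nat) : nat :=
  match w with
  | nil => n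
  | l :: w => letter_perm l (word_perm w n)
  end.

Lemma letter_perm_inv (l : letter) (n : nat) : letter_perm (inv_letter l) (letter_perm l n) = n.
Proof.
  unfold letter_perm. rewrite decode_code, shear_inv_letter. apply code_decode.
Qed.

Lemma letter_perm_order (l : letter) :
  order_perm lexlt_nat (letter_perm l) (letter_perm (inv_letter l)).
Proof.
  split; [split|].
  - intros n. rewrite <- (inv_letter_inv l) at 1. apply letter_perm_inv.
  - intros n. apply letter_perm_inv.
  - intros m n. unfold lexlt_nat, letter_perm. rewrite !decode_code. apply shear_lexlt.
Qed.

Lemma order_perm_comp (lt : nat -> nat -> bool) (s s' t t' : nat -> nat) :
  order_perm lt s s' -> order_perm lt t t' ->
  order_perm lt (fun n => s (t n)) (fun n => t' (s' n)).
Proof.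
  intros [[A1 A2] A3] [[B1 B2] B3]. split; [split|]; intros.
  - rewrite B1. apply A1.
  - rewrite A2. apply B2.
  - rewrite A3. apply B3.
Qed.

Lemma word_perm_order (w : list letter) : exists t, order_perm lexlt_nat (word_perm w) t.
Proof.
  induction w as [|l w [t IH]].
  - exists (fun n => n). repeat split.
  - eexists. apply (order_perm_comp lexlt_nat (letter_perm l)); [apply letter_perm_order | apply IH].
Qed.

Lemma word_perm_code (w : list letter) (v : list Z) : word_perm w (code v) = code (shear_word w v).
Proof.
  induction w as [|l w IH]; simpl; auto. rewrite IH. unfold letter_perm.
  rewrite decode_code. reflexivity.
Qed.

Lemma nat_weight : exists l : nat -> R, weight l /\ forall a, almost_inv l (letter_perm a).
Proof.
  destruct list_weight as (f & Hp & Hs & Hn).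
  set (g := fun n => f (decode n)).
  assert (Eg : ex_series g).
  { apply ex_series_bounded with 2; [intros; apply Rlt_le, Hp|].
    intros N. rewrite sum_n_lsum. unfold g. rewrite <- (lsum_map f decode). apply Hs.
    apply Injective_map_NoDup; [|apply seq_NoDup].
    intros m n E. rewrite <- (code_decode m), E. apply code_decode. }
  set (T := Series g).
  assert (HT : 0 < T).
  { apply Rlt_le_trans with (sum_n g 0); [rewrite sum_O; apply Hp|].
    apply sum_n_le_Series; auto; intros; [apply Rlt_le, Hp | lra]. }
  exists (fun n => / T * g n). split; [split|].
  - intros n. apply Rmult_lt_0_compat; [apply Rinv_0_lt_compat; auto | apply Hp].
  - replace 1 with (/ T * T) by (field; lra).
    apply (is_series_scal (/ T) g). apply Series_correct, Eg.
  - intros a e He. destruct (Hn e He) as (c & Hc & K). exists (/ T * c).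
    assert (IT : 0 < / T) by (apply Rinv_0_lt_compat; auto).
    split; [apply Rmult_lt_0_compat; auto|]. intros n Hlt.
    assert (E : g (letter_perm a n) = f (shear_letter a (decode n)))
      by (unfold g, letter_perm; rewrite decode_code; auto).
    rewrite E in *. destruct (K (decode n) a) as [K1 K2].
    { destruct Hlt as [Hlt | Hlt]; [left | right]; apply Rmult_lt_reg_l in Hlt; auto. }
    unfold g. split.
    + rewrite (Rmult_comm (1 + e)), Rmult_assoc. apply Rmult_le_compat_l; lra.
    + rewrite (Rmult_comm (1 + e)), Rmult_assoc. apply Rmult_le_compat_l; lra.
Qed.

Lemma almost_inv_word (l : nat -> R) (w : list letter) :
  (forall n, 0 < l n) -> (forall a, almost_inv l (letter_perm a)) -> almost_inv l (word_perm w).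
Proof.
  intros Hp Ha. induction w as [|a w IH].
  - intros e He. exists 1. split; [lra|]. intros n _. pose proof (Hp n). simpl. split; nra.
  - apply (almost_inv_comp l (letter_perm a)); auto.
Qed.

(** * Composition, conjugation and the free group of diffeomorphisms *)

(** Renumbering by [t] turns the outer map into the one from the lengths [l (t n)] to [l (s (t n))],
    which starts where the inner one ends. *)
Lemma Phi_comp_perm (lt : nat -> nat -> bool) (l : nat -> R) (s s' t t' : nat -> nat) (x : R) :
  strict_order lt -> weight l -> order_perm lt s s' -> order_perm lt t t' ->
  Phi lt l (fun n => l (s n)) (Phi lt l (fun n => l (t n)) x) = Phi lt l (fun n => l (s (t n))) x.
Proof.
  intros Ho Hl Hs Ht.
  assert (Ws : weight (fun n => l (s n))) by (apply (weight_perm l s s'); auto; apply Hs).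
  rewrite <- (Phi_perm lt l (fun n => l (s n)) t t') by auto.
  apply Phi_cocycle; auto.
  - apply (weight_perm l t t'); auto. apply Ht.
  - apply (weight_perm (fun n => l (s n)) t t'); auto. apply Ht.
Qed.

(** The two inner maps combine to the one from [l'] to [l (s n)]; renumbering the outer map by [s]
    makes it start from [l (s n)]. *)
Lemma Phi_conj_perm (lt : nat -> nat -> bool) (l l' : nat -> R) (s t : nat -> nat) (x : R) :
  strict_order lt -> weight l -> weight l' -> order_perm lt s t ->
  Phi lt l l' (Phi lt l (fun n => l (s n)) (Phi lt l' l x)) = Phi lt l' (fun n => l' (s n)) x.
Proof.
  intros Ho Hl Hl' Hs.
  pose proof (weight_perm l s t (proj1 Hs) Hl). pose proof (weight_perm l' s t (proj1 Hs) Hl').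
  rewrite Phi_cocycle by auto. rewrite <- (Phi_perm lt l l' s t) by auto.
  apply Phi_cocycle; auto.
Qed.

Lemma almost_inv_eventually (l : nat -> R) (s : nat -> nat) : weight l -> almost_inv l s ->
  forall eps, 0 < eps -> exists N, forall n, (N <= n)%nat -> near eps (l n) (l (s n)).
Proof.
  intros Hl Hs eps He. destruct (Hs eps He) as (d & Hd & K).
  destruct (weight_small l d Hl Hd) as [N HN]. exists N. intros n Hn. apply K. left. auto.
Qed.

Lemma almost_inv_small (l : nat -> R) (s : nat -> nat) (d : R) :
  weight l -> almost_inv l s -> 0 < d -> exists N, forall n, (N <= n)%nat -> l (s n) < d.
Proof.
  intros Hl Hs Hd. destruct (almost_inv_eventually l s Hl Hs 1 Rlt_0_1) as [N1 H1].
  destruct (weight_small l (d / 2) Hl ltac:(lra)) as [N2 H2].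
  exists (max N1 N2). intros n Hn. destruct (H1 n ltac:(lia)) as [_ K].
  specialize (H2 n ltac:(lia)). lra.
Qed.

(* G = <f, g> ⊂ Diff^1_+([0,1]); G ≅ F_2 means f, g freely generate G
   (no nontrivial reduced word is the identity on [0,1]); G is C^1-close
   to the identity via conjugators h n with inverses hi n. *)
Theorem theoremt :
  exists f fi g gi : R -> R,
    Diff1plus f /\ Diff1plus g /\ inv01 f fi /\ inv01 g gi /\
    (forall w : list letter, reduced w -> w <> nil ->
       exists x, I01 x /\ eval_word f fi g gi w x <> x) /\
    exists h hi : nat -> R -> R,
      (forall n, Diff1plus (h n) /\ inv01 (h n) (hi n)) /\
      forall w : list letter,
        C1_conv_id (fun n x => h n (eval_word f fi g gi w (hi n x))).
Proof.
  destruct nat_weight as (l & Hl & Ha). pose proof strict_order_lexlt_nat as Ho.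
  set (lt := lexlt_nat) in *.
  set (F := fun a => Phi lt l (fun n => l (letter_perm a n))).
  assert (Wa : forall a, weight (fun n => l (letter_perm a n))).
  { intros a. apply (weight_perm l _ _ (proj1 (letter_perm_order a)) Hl). }
  assert (DF : forall a, Diff1plus (F a)).
  { intros a. apply Diff1plus_Phi; auto. apply almost_inv_eventually; auto. }
  assert (MF : forall a x, I01 x -> I01 (F a x)) by (intros; apply Phi_I01; auto).
  assert (IF1 : forall a x, I01 x -> F (inv_letter a) (F a x) = x).
  { intros a x Hx. unfold F.
    erewrite Phi_comp_perm; auto; try apply letter_perm_order.
    rewrite <- (Phi_id lt l x) at 2 by auto. apply Series_ext. intros n.
    rewrite letter_perm_inv. reflexivity. }
  assert (IF : forall a, inv01 (F a) (F (inv_letter a))).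
  { intros a. split; [|split; [|split]]; try (intros x Hx; apply MF; auto).
    - intros x Hx. auto.
    - intros x Hx. rewrite <- (inv_letter_inv a) at 1. auto. }
  exists (F (false, false)), (F (false, true)), (F (true, false)), (F (true, true)).
  assert (EL : forall a, eval_letter (F (false, false)) (F (false, true))
    (F (true, false)) (F (true, true)) a = F a) by (intros [[] []]; reflexivity).
  assert (EW : forall w x, I01 x -> eval_word (F (false, false)) (F (false, true))
    (F (true, false)) (F (true, true)) w x = Phi lt l (fun n => l (word_perm w n)) x).
  { intros w x Hx. induction w as [|a w IH].
    - symmetry. apply Phi_id; auto.
    - cbn [eval_word]. rewrite IH, EL. destruct (word_perm_order w) as [t Ht].
      apply (Phi_comp_perm lt l _ _ _ _ x Ho Hl (letter_perm_order a) Ht). }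
  assert (Ww : forall (m : nat -> R) w, weight m -> weight (fun n => m (word_perm w n))).
  { intros m w Hm. destruct (word_perm_order w) as [t Ht].
    apply (weight_perm m _ t); auto. apply Ht. }
  assert (Aw : forall w, almost_inv l (word_perm w)) by (intros; apply almost_inv_word; auto; apply Hl).
  split; [apply DF|]. split; [apply DF|]. split; [apply IF|]. split; [apply IF|]. split.
  (* The witness is the left end of the interval of a list moved by [w]: it goes to the left end of
     a different interval. *)
  - intros w Hr Hw. destruct (shear_word_moves w Hr Hw) as [v Hv].
    set (n := code v). assert (Hn : I01 (left_end lt l n)).
    { split; [apply left_end_nonneg; auto|].
      pose proof (left_end_le1 lt l n Ho Hl). pose proof (proj1 Hl n). lra. }
    exists (left_end lt l n). split; auto. rewrite EW, Phi_left_end by auto.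
    destruct (word_perm_order w) as [t Ht]. rewrite (left_end_perm lt l _ t n Ht Hl).
    intros E. apply left_end_inj in E; auto. unfold n in E. rewrite word_perm_code in E.
    apply Hv. rewrite <- (decode_code (shear_word w v)), E. apply decode_code.
  (* For each [k] the lengths are flattened at the threshold [1 / (k + 1)], without reference to a
     word, so one sequence of conjugators serves the whole group. *)
  - destruct (functional_choice (fun k l' => weight l' /\
      (exists tau, 0 < tau /\ forall n, l n <= tau -> l' n = l n) /\
      forall (s : nat -> nat) (e : R), 0 <= e <= 1 ->
        (forall n, l n < / INR (S k) \/ l (s n) < / INR (S k) -> near e (l n) (l (s n))) ->
        forall n, near (3 * e) (l' n) (l' (s n)))) as [m Hm].
    { intros k. apply flatten_weight; auto. apply Rinv_0_lt_compat, lt_0_INR. lia. }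
    exists (fun k => Phi lt l (m k)), (fun k => Phi lt (m k) l). split.
    + intros k. destruct (Hm k) as (Wm & (tau & Htau & Et) & _).
      split; [|apply Phi_inv01; auto]. apply Diff1plus_Phi; auto.
      intros eps He. destruct (weight_small l tau Hl Htau) as [N HN]. exists N. intros n Hn.
      rewrite Et by (apply Rlt_le, HN, Hn). pose proof (proj1 Hl n). split; nra.
    + intros w.
      assert (K : forall k x, I01 x ->
        Phi lt l (m k) (eval_word (F (false, false)) (F (false, true)) (F (true, false))
          (F (true, true)) w (Phi lt (m k) l x)) = Phi lt (m k) (fun n => m k (word_perm w n)) x).
      { intros k x Hx. destruct (Hm k) as (Wm & _). rewrite EW by (apply Phi_I01; auto).
        destruct (word_perm_order w) as [t Ht]. apply (Phi_conj_perm lt l (m k) _ t); auto. }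
      split.
      * intros k. destruct (Hm k) as (Wm & (tau & Htau & Et) & _).
        apply C1_01_ext with (Phi lt (m k) (fun n => m k (word_perm w n)));
          [intros; symmetry; apply K; auto|].
        apply C1_Phi; auto. intros eps He.
        (* [m k] agrees with [l] only where [l] is at most [tau], so both [l n] and
           [l (word_perm w n)] have to be small before their ratio can be used. *)
        destruct (almost_inv_eventually l _ Hl (Aw w) eps He) as [N1 H1].
        destruct (weight_small l tau Hl Htau) as [N2 H2].
        destruct (almost_inv_small l _ tau Hl (Aw w) Htau) as [N3 H3].
        exists (max N1 (max N2 N3)). intros n Hn.
        rewrite !Et; [apply H1; lia | apply Rlt_le, H3; lia | apply Rlt_le, H2; lia].
      (* Flattening turns [e] into [3 * e], which must not exceed 1, and the passage to derivatives
         gives [9 * e], which is below [eps]. *)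
      * intros eps He. set (e := Rmin (1 / 3) (eps / 10)).
        assert (Pe : 0 < e) by (apply Rmin_glb_lt; lra).
        assert (e <= 1 / 3) by apply Rmin_l. assert (e <= eps / 10) by apply Rmin_r.
        (* The word enters only through its threshold [c]: every [k] with [1 / (k + 1) <= c]
           works. *)
        destruct (Aw w e Pe) as (c & Hc & Kc).
        destruct (archimed_cor1 c Hc) as (N & HN & PN).
        exists N. intros k Hk d Hd x Hx. destruct (Hm k) as (Wm & _ & Near).
        assert (Hkc : / INR (S k) <= c).
        { apply Rle_trans with (/ INR N); [|lra].
          apply Rinv_le_contravar; [apply lt_0_INR; lia | apply le_INR; lia]. }
        assert (NN : forall n, near (3 * e) (m k n) (m k (word_perm w n))).
        { apply Near; [lra|]. intros n Hn. apply Kc. destruct Hn; [left | right]; lra. }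
        destruct (Phi_C1_close lt (m k) (fun n => m k (word_perm w n)) (3 * e)
          _ d Ho Wm (Ww _ w Wm) ltac:(lra) NN (K k) Hd x Hx) as [B1 B2].
        split; lra.
Qed.
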